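(* Let $d\geq 1$, let $p=p_d=\frac{2d+1}{4d}$, let $(S_n)$ be the $d$-dimensional elephant random walk with memory parameter $p$, and let $G_n=\frac{1}{n}\sum_{k=1}^n S_k$. Then $$\frac{1}{\sqrt{n\log n}}G_n\xrightarrow{\ \mathcal{L}\ }\mathcal{N}\Bigl(0,\frac{4}{9d}I_d\Bigr)$$ as $n\to\infty$.
   Context: The $d$-dimensional elephant random walk (ERW) with memory parameter $p\in[0,1]$ is defined as follows. Let $e_1,\dots,e_d$ be the standard basis of $\mathbb{R}^d$; the $2d$ directions are $\pm e_1,\dots,\pm e_d$. Set $S_0=0$. The first step $X_1$ is uniformly distributed on the $2d$ directions. For $n\geq 1$, given $X_1,\dots,X_n$, an index $k$ is chosen uniformly at random in $\{1,\dots,n\}$, and then $X_{n+1}=X_k$ with probability $p$, while $X_{n+1}$ equals each of the $2d-1$ remaining directions with probability $(1-p)/(2d-1)$. The position is $S_{n+1}=S_n+X_{n+1}$. $I_d$ is the identity matrix of order $d$; $\xrightarrow{\mathcal{L}}$ denotes convergence in distribution. *)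

(* Defs.v *)
From HB Require Import structures.
From mathcomp Require Import all_boot all_order all_algebra.
From mathcomp Require Import all_classical all_reals all_analysis.
Set Implicit Arguments. Unset Strict Implicit. Unset Printing Implicit Defensive.
Import Order.TTheory GRing.Theory Num.Theory.
Import numFieldNormedType.Exports.
Local Open Scope ring_scope.

Section ERW.
Variable R : realType.

(* The 2d directions +-e_i, encoded as (i, sign) with sign = true for +e_i. *)
Definition dir (d : nat) := ('I_d * bool)%type.

Definition dvec (d : nat) (e : dir d) : 'rV[R]_d :=
  (if e.2 then 1 else -1) *: delta_mx 0 e.1.

(* Conditional law of the next step X_{n+1} = x given the history
   h = [:: X_1; ...; X_n]: uniform if h is empty, otherwise pick k uniformly in
   {1..n}, repeat X_k with prob. p, else one of the 2d-1 other directions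
   uniformly. *)
Definition erw_trans (p : R) (d : nat) (h : seq (dir d)) (x : dir d) : R :=
  if h is [::] then ((2 * d)%:R)^-1
  else (size h)%:R^-1 *
       \sum_(y <- h) (if x == y then p else (1 - p) / (2 * d - 1)%:R).

Definition erw_prob (p : R) (d n : nat) (s : n.-tuple (dir d)) : R :=
  \prod_(i < n) erw_trans p (take i s) (tnth s i).

Definition erw_pos (d : nat) (s : seq (dir d)) (k : nat) : 'rV[R]_d :=
  \sum_(e <- take k s) dvec e.

Definition erw_center (d n : nat) (s : seq (dir d)) : 'rV[R]_d :=
  (n%:R)^-1 *: \sum_(1 <= k < n.+1) erw_pos s k.

Definition erw_expect (p : R) (d n : nat) (F : n.-tuple (dir d) -> R) : R :=
  \sum_(s : n.-tuple (dir d)) erw_prob p s * F s.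

(* Expectation E[g(Z)] for Z ~ N(0, s^2 I_d): iterated Lebesgue integrals
   against the product of d one-dimensional N(0, s^2) densities. *)
Definition set_coord (d : nat) (x : 'rV[R]_d) (k : nat) (t : R) : 'rV[R]_d :=
  \row_(i < d) (if nat_of_ord i == k then t else x 0 i).

Fixpoint gauss_iter (d : nat) (s : R) (k : nat) (g : 'rV[R]_d -> R)
  (x : 'rV[R]_d) : R :=
  match k with
  | 0 => g x
  | k'.+1 => Rintegral (@lebesgue_measure R) setT
      (fun t => normal_pdf 0 s t * gauss_iter s k' g (set_coord x k' t))
  end.

Definition gauss_expect (d : nat) (s : R) (g : 'rV[R]_d -> R) : R :=
  gauss_iter s d g 0.

End ERW.

(* Main.v *)
Require Import Defs.
From HB Require Import structures.
From mathcomp Require Import all_boot all_order all_algebra.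
From mathcomp Require Import all_classical all_reals all_analysis.
From mathcomp Require Import measurable_realfun ring lra zify.
Import Order.TTheory GRing.Theory Num.Theory.
Import numFieldNormedType.Exports.
Local Open Scope classical_set_scope.
Local Open Scope ring_scope.

(* For p = (2d+1)/(4d) the next step is, with probability 1/2 each, a uniformly
   chosen past step or a fresh uniform direction, so E[S_(n+1) | F_n] =
   (1 + 1/(2n)) S_n.  Hence sum_(k <= n) S_k - (2n+1)/3 S_n is a martingale with
   second moment at most n^3, and G_n differs from (2/3) S_n by O(sqrt n) in L^2:
   it suffices to treat S_n.  For a direction theta put Y_k = theta . S_k.
   A second-order expansion of cos (c Y_(k+1) / sqrt (k+1) + phi) around
   c Y_k / sqrt k + phi multiplies its expectation by
   1 - c^2 |theta|^2 / (2 d (k+1)) up to an error of order k^(-3/2); here the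
   conditional variance is controlled by E (sum_(j <= k) v X_j)^2 <= k H_k for
   centered v.  Multiplying these factors gives exp (- c^2 |theta|^2 H_n / (2d)),
   and c^2 H_n converges when c = (2/3) / sqrt (log n).

   A bounded continuous f is a limit, uniformly on cubes, of trigonometric
   polynomials with the same bound (Bernstein polynomials in sin (x_i / (2T))).
   Second moments give tightness on the side of the walk, and dominated
   convergence the passage to the limit in the iterated Gaussian integrals. *)

(** * Taylor estimates for sine, cosine and the exponential *)

Section Elementary.
Variable R : realType.
Implicit Types x y h A : R.

Lemma MVT_everywhere (f df : R -> R) (a b : R) : a <= b ->
  (forall t : R, is_derive t 1 f (df t)) ->
  exists2 c, a <= c <= b & f b - f a = df c * (b - a).
Proof.
move=> ab fdf.
have cf : {within `[a, b], continuous f}.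
  apply: derivable_within_continuous => t _.
  by have [] := fdf t.
have [c cab e] := @MVT_segment R f df a b ab (fun t _ => fdf t) cf.
by exists c => //; move: cab; rewrite in_itv.
Qed.

Lemma cos_lipschitz x y : `|cos x - cos y| <= `|x - y|.
Proof.
wlog yx : x y / y <= x.
  move=> H; case: (leP y x) => [|/ltW] xy; first exact: H.
  by rewrite distrC [leRHS]distrC H.
have [c _ ->] := @MVT_everywhere cos (fun t => - sin t) y x yx (fun t => is_derive_cos t).
by rewrite normrM normrN ler_piMl// sin_max.
Qed.

Lemma sin_lex x : 0 <= x -> sin x <= x.
Proof.
move=> x0.
have [c _] := @MVT_everywhere sin cos 0 x x0 (fun t => is_derive_sin t).
by rewrite sin0 !subr0 => ->; rewrite ler_piMl// cos_le1.
Qed.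

Lemma norm_sin_le x : `|sin x| <= `|x|.
Proof.
have := cos_lipschitz (x - pi / 2) (- (pi / 2)).
by rewrite cosBpihalf cosN cos_pihalf subr0 opprK subrK.
Qed.

Lemma subr1_cos_ge x : 0 <= x -> 0 <= 1 - cos x <= x.
Proof.
move=> x0; rewrite subr_ge0 cos_le1/=.
have := cos_lipschitz 0 x; rewrite cos0 sub0r normrN (ger0_norm x0).
exact: le_trans (ler_norm _).
Qed.

Lemma subr1_cos_le_sqr x : 0 <= x -> 1 - cos x <= x ^+ 2.
Proof.
move=> x0.
have [c /andP[c0 cx]] := @MVT_everywhere cos (fun t => - sin t) 0 x x0 (fun t => is_derive_cos t).
rewrite cos0 subr0 -opprB mulNr => /oppr_inj ->.
by rewrite expr2 ler_wpM2r// (le_trans (sin_lex c c0)).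
Qed.

(** The derivative [1 - cos x] is at most [x] and at most [x ^+ 2]. The quadratic bound feeds the
    expansion of the cosine, the cubic one the sine term in [cos_taylor2]. *)
Lemma subr_sin_bounds x : 0 <= x ->
  [/\ 0 <= x - sin x, x - sin x <= x ^+ 2 & x - sin x <= x ^+ 3].
Proof.
move=> x0; split; first by rewrite subr_ge0 sin_lex.
all: have [c /andP[c0 cx]] := @MVT_everywhere (fun t => t - sin t) (fun t => 1 - cos t) 0 x x0 (fun t => ltac:(exact _)).
all: rewrite sin0 !subr0 => ->.
- rewrite expr2 ler_wpM2r//; have /andP[_ H] := subr1_cos_ge c c0.
  exact: le_trans H cx.
- rewrite exprSr ler_wpM2r// (le_trans (subr1_cos_le_sqr c c0))//.
  by rewrite ler_sqr.
Qed.

Lemma cos_taylor2_ge0 x : 0 <= x -> `|cos x - 1 + x ^+ 2 / 2| <= x ^+ 3.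
Proof.
move=> x0.
have H (t : R) : is_derive t 1 (fun t : R => cos t + t ^+ 2 / 2) (t - sin t).
  apply: is_derive_eq; rewrite /GRing.scale/=.
  by field.
have [c /andP[c0 cx]] := @MVT_everywhere _ _ 0 x x0 H.
rewrite cos0 expr0n mul0r addr0 subr0 => e.
have -> : cos x - 1 + x ^+ 2 / 2 = (c - sin c) * x by rewrite -e; ring.
have [h1 h2 _] := subr_sin_bounds c c0.
rewrite ger0_norm ?mulr_ge0// exprSr ler_wpM2r// (le_trans h2)//.
by rewrite ler_sqr.
Qed.

(** The addition formula splits the remainder into a cosine part and a sine part, each at most
    |h|^3. *)
Lemma cos_taylor2 A h :
  `|cos (A + h) - (cos A - h * sin A - h ^+ 2 / 2 * cos A)| <= 2 * `|h| ^+ 3.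
Proof.
have Hc : `|cos h - 1 + h ^+ 2 / 2| <= `|h| ^+ 3.
  by rewrite -cos_norm -(real_normK (num_real h)) cos_taylor2_ge0.
have Hs : `|h - sin h| <= `|h| ^+ 3.
  have [h0|h0] := leP 0 h.
    by have [a _ b] := subr_sin_bounds h h0; rewrite !ger0_norm.
  have [|a _ b] := subr_sin_bounds (- h); first by rewrite oppr_ge0 ltW.
  rewrite -normrN opprB; move: a b; rewrite sinN opprK addrC => a b.
  by rewrite ger0_norm// (ltr0_norm h0).
have -> : cos (A + h) - (cos A - h * sin A - h ^+ 2 / 2 * cos A) =
  cos A * (cos h - 1 + h ^+ 2 / 2) + sin A * (h - sin h).
  by rewrite cosD; ring.
apply: (le_trans (ler_normD _ _)); rewrite !normrM mulr_natl mulr2n.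
by apply: lerD; rewrite -[leRHS]mul1r ler_pM// ?cos_max ?sin_max.
Qed.

(** Since 1 - x <= exp (-x) <= 1 / (1 + x), it suffices that (1 - x + x^2) (1 + x) = 1 + x^3 >=
    1. *)
Lemma expRN_taylor1 x : 0 <= x -> `|expR (- x) - (1 - x)| <= x ^+ 2.
Proof.
move=> x0; have := expR_ge1Dx (- x) => h1.
rewrite ger0_norm ?subr_ge0//.
have h2 : expR (- x) <= (1 + x)^-1.
  by rewrite expRN lef_pV2 ?posrE ?expR_gt0 ?expR_ge1Dx// ltr_wpDr.
rewrite lerBlDr (le_trans h2)// -[leLHS]mul1r ler_pdivrMr ?ltr_wpDr//.
rewrite -subr_ge0 (_ : _ - _ = x ^+ 3); last by ring.
by rewrite exprn_ge0.
Qed.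

End Elementary.

(** * Expectations along the walk at the critical parameter *)

Section ERWExpectation.
Variables (R : realType) (d : nat).
Hypothesis d_gt0 : (0 < d)%N.

Definition crit_p : R := (2 * d + 1)%:R / (4 * d)%:R.

Local Notation p := crit_p.
Local Notation dir := (dir d).

(** The functional acts on plain sequences, so that the same [F] can be used at all times without
    casts between tuple lengths. *)
Definition erwE (n : nat) (F : seq dir -> R) : R :=
  erw_expect p (fun s : n.-tuple dir => F s).

Lemma dR_gt0 : 0 < d%:R :> R. Proof. by rewrite ltr0n. Qed.

Lemma crit_pE : p = 2^-1 + ((4 * d)%:R)^-1.
Proof.
rewrite /p natrD natrM (natrM _ 4); have := dR_gt0 => ?.
by field; rewrite gt_eqF.
Qed.

Lemma crit_p_compl : (1 - p) / (2 * d - 1)%:R = ((4 * d)%:R)^-1.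
Proof.
have d0 := dR_gt0.
have e0 : 0 < (2 * d - 1)%:R :> R by rewrite ltr0n; lia.
have -> : 1 - p = (2 * d - 1)%:R / (4 * d)%:R.
  rewrite /p natrB; last by lia.
  rewrite natrD !natrM.
  by field; rewrite gt_eqF.
by rewrite mulrAC divff ?mul1r// gt_eqF.
Qed.

Lemma card_dir : #|{: dir}| = (2 * d)%N.
Proof. by rewrite card_prod card_ord card_bool mulnC. Qed.

Lemma sum_seq_cst (T : Type) (h : seq T) (a : R) :
  \sum_(y <- h) a = (size h)%:R * a.
Proof.
elim: h => [|y h IH]; first by rewrite big_nil mul0r.
by rewrite big_cons IH/= -[in RHS]natr1 mulrDl mul1r addrC.
Qed.

(** As p = 1/2 + 1/(4d) and (1 - p)/(2d - 1) = 1/(4d), the transition law is the half-and-half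
    mixture of a uniform past step and a fresh uniform direction. *)
Lemma sum_erw_trans (h : seq dir) (v : dir -> R) : (0 < size h)%N ->
  \sum_x erw_trans p h x * v x =
  (2 * (size h)%:R)^-1 * (\sum_(y <- h) v y) + ((4 * d)%:R)^-1 * \sum_x v x.
Proof.
case: h => // a h' _; set h := a :: h'.
have n0 : 0 < (size h)%:R :> R by rewrite ltr0n.
have {1}-> : erw_trans p h = fun x => (size h)%:R^-1 *
  \sum_(y <- h) (if x == y then 2^-1 + ((4 * d)%:R)^-1 else ((4 * d)%:R)^-1).
  by rewrite -crit_pE -crit_p_compl.
under eq_bigr do rewrite -mulrA mulr_suml.
rewrite -mulr_sumr exchange_big/=.
have -> : \sum_(y <- h) \sum_x (if x == y then 2^-1 + ((4 * d)%:R)^-1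
    else ((4 * d)%:R)^-1) * v x =
   \sum_(y <- h) (2^-1 * v y + ((4 * d)%:R)^-1 * \sum_x v x).
  apply: eq_bigr => y _.
  (* Every direction has weight 1/(4d); the repeated one carries an extra 1/2. *)
  have -> : \sum_x (if x == y then 2^-1 + ((4 * d)%:R)^-1
    else ((4 * d)%:R)^-1) * v x = \sum_x ((if x == y then 2^-1 * v x else 0)
     + ((4 * d)%:R)^-1 * v x).
    by apply: eq_bigr => x _; case: ifP => _; rewrite ?mulrDl ?add0r.
  by rewrite big_split/= -big_mkcond big_pred1_eq mulr_sumr.
rewrite big_split/= -mulr_sumr sum_seq_cst.
rewrite mulrDr invfM -!mulrA; congr (_ + _).
  by rewrite mulrCA.
by rewrite mulKf// gt_eqF.
Qed.

Lemma sum_erw_trans_nil (v : dir -> R) :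
  \sum_x erw_trans p [::] x * v x = ((2 * d)%:R)^-1 * \sum_x v x.
Proof. by rewrite mulr_sumr. Qed.

Lemma erw_trans_ge0 (h : seq dir) x : 0 <= erw_trans p h x.
Proof.
case: h => [|a h] /=; first by rewrite invr_ge0 ler0n.
rewrite mulr_ge0// ?invr_ge0// sumr_ge0// => y _; case: ifP => _.
  by rewrite /p divr_ge0.
by rewrite crit_p_compl invr_ge0.
Qed.

Lemma sum_erw_trans1 (h : seq dir) : \sum_x erw_trans p h x = 1.
Proof.
have d0 := dR_gt0.
have -> : \sum_x erw_trans p h x = \sum_x erw_trans p h x * (fun=> 1) x.
  by apply: eq_bigr => x _; rewrite mulr1.
case: h => [|a h].
  rewrite sum_erw_trans_nil sumr_const card_dir mulVf// pnatr_eq0; lia.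
rewrite sum_erw_trans// sumr_const card_dir sum_seq_cst mulr1.
rewrite !natrM; have n0 : 0 < (size (a :: h))%:R :> R by rewrite ltr0n.
field.
by rewrite !gt_eqF.
Qed.

Lemma erw_prob_rcons n (s : n.-tuple dir) x :
  erw_prob p [tuple of rcons s x] = erw_prob p s * erw_trans p s x.
Proof.
rewrite /erw_prob big_ord_recr/=; congr (_ * _).
  apply: eq_bigr => i _; congr erw_trans.
    by rewrite -cats1 takel_cat// size_tuple ltnW.
  by rewrite !(tnth_nth x)/= nth_rcons size_tuple ltn_ord.
rewrite (tnth_nth x)/= nth_rcons size_tuple ltnn eqxx.
by rewrite -cats1 takel_cat ?size_tuple// take_oversize// size_tuple.
Qed.

(** Conditioning on the first [n] steps: a tuple of length n + 1 is a tuple of length [n] and a last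
    step. All recursions in time go through this identity. *)
Lemma erwES n F : erwE n.+1 F =
  erwE n (fun h => \sum_x erw_trans p h x * F (rcons h x)).
Proof.
rewrite /erwE /erw_expect.
under [RHS]eq_bigr do rewrite mulr_sumr.
rewrite pair_big/=.
pose g (sx : n.-tuple dir * dir) : n.+1.-tuple dir := [tuple of rcons sx.1 sx.2].
have gb : bijective g.
  have x0 : dir := (Ordinal d_gt0, true).
  exists (fun t : n.+1.-tuple dir =>
    ([tuple of belast (thead t) (behead t)], last x0 t)).
    case=> s x; congr pair; last by rewrite /g /= last_rcons.
    apply: val_inj; rewrite /= /thead (tnth_nth x0) /=.
    by case: (tval s) => //= a s'; rewrite belast_rcons.
  move=> t; apply: val_inj => /=.
  by case: (tupleP t) => a u; rewrite /= theadE -lastI.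
rewrite (reindex g)/=; last exact: onW_bij.
by apply: eq_bigr => -[s x] _; rewrite erw_prob_rcons mulrA.
Qed.

Lemma erwE0 F : erwE 0 F = F [::].
Proof.
rewrite /erwE /erw_expect (big_pred1 [tuple]); last first.
  by move=> s /=; apply/esym/eqP; exact: tuple0.
by rewrite /erw_prob big_ord0 mul1r.
Qed.

Lemma eq_erwE n F G : (forall h, size h = n -> F h = G h) -> erwE n F = erwE n G.
Proof. by move=> FG; apply: eq_bigr => s _; rewrite FG// size_tuple. Qed.

Lemma erw_prob_ge0 n (s : n.-tuple dir) : 0 <= erw_prob p s.
Proof. by apply: prodr_ge0 => i _; exact: erw_trans_ge0. Qed.

Lemma le_erwE n F G : (forall h, size h = n -> F h <= G h) -> erwE n F <= erwE n G.
Proof.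
move=> FG; apply: ler_sum => s _; rewrite ler_wpM2l ?erw_prob_ge0//.
by rewrite FG// size_tuple.
Qed.

Lemma erwED n F G : erwE n (fun h => F h + G h) = erwE n F + erwE n G.
Proof. by rewrite -big_split; apply: eq_bigr => s _; rewrite mulrDr. Qed.

Lemma erwEZ n a F : erwE n (fun h => a * F h) = a * erwE n F.
Proof. by rewrite /erwE /erw_expect mulr_sumr; apply: eq_bigr => s _; rewrite mulrCA. Qed.

Lemma erwEN n F : erwE n (fun h => - F h) = - erwE n F.
Proof. by rewrite -[RHS]mulN1r -erwEZ; apply: eq_erwE => h _; rewrite mulN1r. Qed.

Lemma erwEB n F G : erwE n (fun h => F h - G h) = erwE n F - erwE n G.
Proof. by rewrite erwED erwEN. Qed.

Lemma erwE1 n a : erwE n (fun=> a) = a.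
Proof.
elim: n => [|n IH]; first by rewrite erwE0.
rewrite erwES -[RHS]IH; apply: eq_erwE => h _.
by rewrite -mulr_suml sum_erw_trans1 mul1r.
Qed.

Lemma ler_norm_erwE n F G : (forall h, size h = n -> `|F h| <= G h) ->
  `|erwE n F| <= erwE n G.
Proof.
move=> FG; rewrite ler_norml -erwEN; apply/andP; split; apply: le_erwE => h /FG;
  by rewrite ler_norml => /andP[].
Qed.

(** Young's inequality |F| <= F^2 / (2a) + a/2 does the work of Cauchy-Schwarz. *)
Lemma erwE_norm_le_sqr n F a : 0 < a -> erwE n (fun h => F h ^+ 2) <= a ^+ 2 ->
  erwE n (fun h => `|F h|) <= a.
Proof.
move=> a0 Fa.
have -> : a = (2 * a)^-1 * a ^+ 2 + 2^-1 * a by field; rewrite gt_eqF.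
apply: (@le_trans _ _ ((2 * a)^-1 * erwE n (fun h => F h ^+ 2) + 2^-1 * a)); last first.
  by rewrite lerD2r ler_wpM2l// invr_ge0 mulr_ge0// ltW.
rewrite -erwEZ -[X in _ + X](erwE1 n) -erwED; apply: le_erwE => h _.
rewrite -(real_normK (num_real (F h))); set t := `|F h|.
have -> : (2 * a)^-1 * t ^+ 2 + 2^-1 * a = (t - a) ^+ 2 * (2 * a)^-1 + t.
  by field; rewrite gt_eqF.
by rewrite lerDr mulr_ge0 ?sqr_ge0// invr_ge0 mulr_ge0// ltW.
Qed.

End ERWExpectation.

(** * Second moments of sums along the path *)

Section Moments.
Variables (R : realType) (d : nat).
Hypothesis d_gt0 : (0 < d)%N.
Local Notation p := (crit_p R d).
Local Notation dir := (dir d).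
Local Notation erwE := (@erwE R d).

(** For v e = theta . e this is theta . S_n; a general [v] also covers the fluctuations of the
    conditional variance, see [centered_sqr]. *)
Definition pathsum (v : dir -> R) (h : seq dir) : R := \sum_(y <- h) v y.

Lemma pathsum_rcons v h x : pathsum v (rcons h x) = pathsum v h + v x.
Proof. by rewrite /pathsum -cats1 big_cat big_seq1. Qed.

Lemma pathsum_nil v : pathsum v [::] = 0.
Proof. by rewrite /pathsum big_nil. Qed.

Lemma norm_pathsum_le v h : (forall x, `|v x| <= 1) -> `|pathsum v h| <= (size h)%:R.
Proof.
move=> v1; rewrite (le_trans (ler_norm_sum _ _ _))//.
by rewrite -[leRHS]mulr1 -sum_seq_cst ler_sum.
Qed.

Definition harm (n : nat) : R := \sum_(k < n) k.+1%:R^-1.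

Lemma harmS n : harm n.+1 = harm n + n.+1%:R^-1.
Proof. by rewrite /harm big_ord_recr. Qed.

Lemma harm_nd m n : (m <= n)%N -> harm m <= harm n.
Proof.
move=> /subnK <-; elim: (n - m)%N => [//|k IH]; rewrite addSn harmS.
by rewrite (le_trans IH)// lerDl invr_ge0.
Qed.

Lemma trans_lin h (a b c : R) (v u : dir -> R) :
  \sum_x erw_trans p h x * (a + b * v x + c * u x) =
  a + b * (\sum_x erw_trans p h x * v x) + c * (\sum_x erw_trans p h x * u x).
Proof.
rewrite -[X in X + _ + _]mul1r -(sum_erw_trans1 R d d_gt0 h) mulr_suml !mulr_sumr.
by rewrite -!big_split/=; apply: eq_bigr => x _; ring.
Qed.

Lemma le_trans_sum h (u v : dir -> R) : (forall x, u x <= v x) ->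
  \sum_x erw_trans p h x * u x <= \sum_x erw_trans p h x * v x.
Proof. by move=> uv; apply: ler_sum => x _; rewrite ler_wpM2l ?erw_trans_ge0. Qed.

Lemma trans_sum_cst (h : seq dir) (a : R) : \sum_x erw_trans p h x * a = a.
Proof. by rewrite -mulr_suml sum_erw_trans1// mul1r. Qed.

Lemma trans_sum_sqr_le1 h (v : dir -> R) : (forall x, `|v x| <= 1) ->
  \sum_x erw_trans p h x * v x ^+ 2 <= 1.
Proof.
move=> v1; rewrite -[leRHS](trans_sum_cst h); apply: le_trans_sum => x.
by rewrite -(real_normK (num_real (v x))) exprn_ile1.
Qed.

Lemma trans_sum_centered h (v : dir -> R) : (0 < size h)%N -> \sum_x v x = 0 ->
  \sum_x erw_trans p h x * v x = (2 * (size h)%:R)^-1 * pathsum v h.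
Proof. by move=> h0 v0; rewrite sum_erw_trans// v0 mulr0 addr0. Qed.

(** The cross term has conditional mean 2 Y * Y / (2n), so the second moments satisfy a_(n+1) <= (1
    + 1/n) a_n + 1, a recursion that n H_n solves with equality. The factor H_n is the critical
    growth. *)
Lemma erwE_pathsum_sqr (v : dir -> R) n : \sum_x v x = 0 -> (forall x, `|v x| <= 1) ->
  erwE n (fun h => pathsum v h ^+ 2) <= n%:R * harm n.
Proof.
move=> v0 v1; elim: n => [|n IH].
  by rewrite erwE0 pathsum_nil expr0n mul0r.
rewrite erwES//.
(* The first step has its own law, so the passage from time 0 to time 1 is treated apart. *)
have [->|n0] := posnP n.
  rewrite erwE0 harmS /harm big_ord0 add0r invr1 mulr1.
  under eq_bigr do rewrite pathsum_rcons pathsum_nil add0r.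
  exact: trans_sum_sqr_le1.
have nR : 0 < n%:R :> R by rewrite ltr0n.
have -> : n.+1%:R * harm n.+1 = (1 + n%:R^-1) * (n%:R * harm n) + 1.
  rewrite harmS -natr1; field.
  by rewrite natr1 !pnatr_eq0 -lt0n n0.
apply: (@le_trans _ _ (erwE n (fun h => (1 + n%:R^-1) * pathsum v h ^+ 2 + 1))).
  apply: (le_erwE R d d_gt0) => h hn.
  under eq_bigr do rewrite pathsum_rcons.
  have -> : \sum_x erw_trans p h x * (pathsum v h + v x) ^+ 2 =
     \sum_x erw_trans p h x * (pathsum v h ^+ 2 + (2 * pathsum v h) * v x + 1 * v x ^+ 2).
    by apply: eq_bigr => x _; congr (_ * _); ring.
  rewrite (trans_lin h _ _ _ v (fun x => v x ^+ 2)) mul1r.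
  rewrite lerD ?trans_sum_sqr_le1// trans_sum_centered ?hn//.
  by rewrite le_eqVlt; apply/orP; left; apply/eqP; field; rewrite gt_eqF.
by rewrite erwED erwE1// lerD2r erwEZ ler_wpM2l// addr_ge0// invr_ge0 ltW.
Qed.

(** Any bound [L] on the square root of H_n is allowed, so that one value serves all times up to a
    horizon. *)
Lemma erwE_norm_pathsum (v : dir -> R) n (L : R) : (0 < n)%N -> 0 < L ->
  \sum_x v x = 0 -> (forall x, `|v x| <= 1) -> harm n <= L ^+ 2 ->
  erwE n (fun h => `|pathsum v h|) <= L * Num.sqrt n%:R.
Proof.
move=> n0 L0 v0 v1 HL; apply: erwE_norm_le_sqr => //.
  by rewrite mulr_gt0// sqrtr_gt0 ltr0n.
rewrite (le_trans (erwE_pathsum_sqr v n v0 v1))// exprMn sqr_sqrtr// mulrC.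
by rewrite ler_wpM2r.
Qed.

(** For the projection v e = theta . e this is theta . (n G_n). *)
Definition possum (v : dir -> R) (h : seq dir) : R :=
  \sum_(1 <= k < (size h).+1) pathsum v (take k h).

Lemma possum_rcons v h x : possum v (rcons h x) = possum v h + pathsum v h + v x.
Proof.
rewrite /possum size_rcons big_nat_recr//= -addrA -pathsum_rcons; congr (_ + _).
  apply: eq_big_nat => k /andP[_ kh]; rewrite -cats1 takel_cat//.
by rewrite take_oversize// size_rcons.
Qed.

(* The coefficient (2 n + 1) / 3 is the one that makes
   sum_(k <= n) S_k - (2 n + 1) / 3 S_n a martingale. *)
Lemma erwE_possum_mart_sqr (v : dir -> R) n : \sum_x v x = 0 -> (forall x, `|v x| <= 1) ->
  erwE n (fun h => (possum v h - (2 * n%:R + 1) / 3 * pathsum v h) ^+ 2) <= n%:R ^+ 3.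
Proof.
move=> v0 v1; elim: n => [|n IH].
  by rewrite erwE0 pathsum_nil /possum big_geq// mulr0 subr0 !expr0n.
rewrite erwES//.
have [->|n0] := posnP n.
  rewrite erwE0.
  under eq_bigr do rewrite possum_rcons pathsum_rcons pathsum_nil /possum big_geq// !add0r.
  (* At time 1 the coefficient is 1 and both sums reduce to [v x], so the difference vanishes. *)
  rewrite big1 ?exprn_ge0// => x _.
  by rewrite (_ : _ - _ = 0) ?expr0n ?mulr0//; field.
have nR : 0 < n%:R :> R by rewrite ltr0n.
set D := (X in erwE n X <= _) in IH.
apply: (@le_trans _ _ (erwE n (fun h => D h + n%:R ^+ 2))); last first.
  rewrite erwED erwE1// (le_trans (lerD IH (lexx _)))// -natr1; nra.
apply: (le_erwE R d d_gt0) => h hn; rewrite /D.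
set T := possum v h; set Y := pathsum v h; set D0 := T - _.
have -> : \sum_x erw_trans p h x *
    (possum v (rcons h x) - (2 * n.+1%:R + 1) / 3 * pathsum v (rcons h x)) ^+ 2 =
   \sum_x erw_trans p h x * ((D0 + Y / 3) ^+ 2 + (- (2 * n%:R / 3) * 2 * (D0 + Y / 3)) * v x
     + (2 * n%:R / 3) ^+ 2 * v x ^+ 2).
  apply: eq_bigr => x _; congr (_ * _).
  rewrite possum_rcons pathsum_rcons -/T -/Y /D0 -natr1; by field.
rewrite (trans_lin h _ _ _ v (fun x => v x ^+ 2)) trans_sum_centered ?hn// -/Y.
have := trans_sum_sqr_le1 h v v1; set q := \sum_x _ => q1.
(* The drift of the new step cancels Y/3 in the mean. In the second moment only -(Y/3)^2 remains of
   it, which is dropped; the growth per step is then at most (2n/3)^2 <= n^2. *)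
have -> : (D0 + Y / 3) ^+ 2 + - (2 * n%:R / 3) * 2 * (D0 + Y / 3) * ((2 * n%:R)^-1 * Y) =
   D0 ^+ 2 - (Y / 3) ^+ 2 by field; rewrite gt_eqF.
have : 0 <= (Y / 3) ^+ 2 by exact: sqr_ge0.
nra.
Qed.

End Moments.

(** * Increments of k^(-1/2) *)

Section StepEstimates.
Variable R : realType.

(** Here r = sqrt k and r' = sqrt (k+1); everything follows from 1/r - 1/r' = 1 / (r r' (r + r')).
    The three bounds control the renormalization, let errors of order k^(-3/2) telescope, and
    compare the renormalization with the drift 1 / (2 k sqrt (k+1)) of the walk. *)
Lemma inv_sqrt_estimates (r r' : R) : 1 <= r -> 0 < r' -> r' ^+ 2 = r ^+ 2 + 1 ->
  [/\ 0 <= r^-1 - r'^-1 <= r^-1 ^+ 3,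
      r^-1 ^+ 3 <= 4 * (r^-1 - r'^-1) &
      `|(2 * r ^+ 2 * r')^-1 - (r^-1 - r'^-1)| <= r^-1 ^+ 5].
Proof.
move=> r1 r'0 rr'.
have r0 : 0 < r by lra.
have rler' : r <= r' by nra.
have r'2 : 2 * r' <= 3 * r by nra.
have -> : r^-1 - r'^-1 = (r * r' * (r + r'))^-1.
  have : r' - r = (r + r')^-1.
    apply: (@mulIf _ (r + r')); first by rewrite gt_eqF// addr_gt0.
    by rewrite mulVf ?gt_eqF ?addr_gt0//; nra.
  move=> e; rewrite -(mulrA r) !invfM -e; field.
  by rewrite !gt_eqF.
split.
- apply/andP; split; first by rewrite invr_ge0 !mulr_ge0// ?addr_ge0// ltW.
  rewrite exprVn lef_pV2 ?posrE ?exprn_gt0 ?mulr_gt0 ?addr_gt0//; nra.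
- rewrite -[4]invrK -invfM exprVn lef_pV2 ?posrE ?exprn_gt0 ?mulr_gt0 ?addr_gt0 ?invr_gt0//.
  rewrite mulrC ler_pdivrMr//.
  have : r' * (r + r') <= 4 * r ^+ 2 by nra.
  by nra.
- have -> : (2 * r ^+ 2 * r')^-1 - (r * r' * (r + r'))^-1 =
     (2 * r ^+ 2 * r' * (r + r') ^+ 2)^-1.
    have e : 1 = (r' - r) * (r + r') by nra.
    rewrite -[in RHS](mul1r (_^-1)) [X in _ = X * _]e; field.
    by rewrite !gt_eqF// addr_gt0.
  rewrite ger0_norm ?invr_ge0 ?mulr_ge0 ?exprn_ge0 ?addr_ge0 ?(ltW r0) ?(ltW r'0)//.
  rewrite exprVn lef_pV2 ?posrE ?exprn_gt0 ?mulr_gt0 ?exprn_gt0 ?addr_gt0//.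
  have -> : r ^+ 5 = r ^+ 2 * r * r ^+ 2 by ring.
  rewrite ler_pM ?mulr_ge0 ?exprn_ge0 ?(ltW r0)//; last by rewrite ler_sqr ?nnegrE ?addr_ge0 ?ltW// ltrDl.
  have : 0 <= r ^+ 2 by exact: sqr_ge0.
  by nra.
Qed.

End StepEstimates.

(** * Cosine transform of the normalized walk *)

Section CharacteristicFunction.
Variables (R : realType) (d : nat).
Hypothesis d_gt0 : (0 < d)%N.
Local Notation p := (crit_p R d).
Local Notation dir := (dir d).
Local Notation erwE := (@erwE R d).
Variable w : dir -> R.
Hypothesis w0 : \sum_x w x = 0.
Hypothesis w1 : forall x, `|w x| <= 1.

(** The variance of [w] under the uniform law on directions, [w] being centered; for the projection
    on theta it is |theta|^2 / d. *)
Definition mean_sqr : R := ((2 * d)%:R)^-1 * \sum_x w x ^+ 2.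
Local Notation q := mean_sqr.

Lemma sqr_step_le1 x : w x ^+ 2 <= 1.
Proof. by rewrite -(real_normK (num_real (w x))) exprn_ile1. Qed.

Lemma card_dir_gt0 : 0 < (2 * d)%:R :> R.
Proof. by rewrite ltr0n; lia. Qed.

Lemma mean_sqr_ge0 : 0 <= q.
Proof. by rewrite mulr_ge0 ?invr_ge0// sumr_ge0// => x _; exact: sqr_ge0. Qed.

Lemma mean_sqr_le1 : q <= 1.
Proof.
rewrite /q ler_pdivrMl ?card_dir_gt0// mulr1 -card_dir -sum1_card natr_sum.
by apply: ler_sum => x _; exact: sqr_step_le1.
Qed.

(** The conditional second moment of the next step is [q] plus the path sum of this function over
    2k. As it is centered and bounded by 1, the bounds on [pathsum] apply to it. *)
Definition centered_sqr x : R := w x ^+ 2 - q.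

Lemma sum_centered_sqr : \sum_x centered_sqr x = 0.
Proof.
rewrite big_split/= sumr_const card_dir -mulr_natl mulrN mulrA mulfV ?mul1r ?subrr//.
by rewrite gt_eqF ?card_dir_gt0.
Qed.

Lemma centered_sqr_le1 x : `|centered_sqr x| <= 1.
Proof.
have := sqr_step_le1 x; have := mean_sqr_ge0; have := mean_sqr_le1.
have := sqr_ge0 (w x); rewrite /centered_sqr ler_norml => *; apply/andP; split; lra.
Qed.

Variables (c phi : R).
Hypothesis c_ge0 : 0 <= c.

(* The normalization sqrt k replaces the exact martingale normalization
   prod_(j < k) (1 + 1 / (2 j)); the resulting drift is of order k^(-5/2) Y_k. *)
Definition charf (k : nat) : R :=
  erwE k (fun h => cos (c * (pathsum R d w h / Num.sqrt k%:R) + phi)).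

(** Second-order expansion of the cosine at the current argument. The order zero term and the mean
    variance [q] give the factor in front; the conditional drift, the fluctuation of the variance
    and the cubic remainder make up the error. *)
Lemma charf_step_cond k (h : seq dir) : (0 < k)%N -> size h = k ->
  `| \sum_x erw_trans p h x * cos (c * (pathsum R d w (rcons h x) / Num.sqrt k.+1%:R) + phi)
    - (1 - c ^+ 2 * q / (2 * k.+1%:R)) * cos (c * (pathsum R d w h / Num.sqrt k%:R) + phi) |
  <= (c + 16 * c ^+ 3) * (Num.sqrt k%:R)^-1 ^+ 3 +
     c ^+ 2 * (`|pathsum R d centered_sqr h| * (Num.sqrt k%:R)^-1 ^+ 4 + `|pathsum R d w h| * (Num.sqrt k%:R)^-1 ^+ 4).
Proof.
move=> k0 hk; set r := Num.sqrt k%:R; set r' := Num.sqrt k.+1%:R.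
have kR : 1 <= k%:R :> R by rewrite ler1n.
have r2 : r ^+ 2 = k%:R by rewrite sqr_sqrtr.
have r'2 : r' ^+ 2 = r ^+ 2 + 1 by rewrite r2 sqr_sqrtr// natr1.
have r1 : 1 <= r by rewrite -[leLHS]sqrtr1 ler_wsqrtr.
have r0 : 0 < r by lra.
have r'0 : 0 < r' by rewrite sqrtr_gt0 ltr0n.
have [/andP[eta0 eta1] _ eta2] := inv_sqrt_estimates R r r' r1 r'0 r'2.
set eta := r^-1 - r'^-1 in eta0 eta1 eta2.
set Y := pathsum R d w h; set W := pathsum R d centered_sqr h.
have Yk : `|Y| <= r ^+ 2 by rewrite r2 -hk norm_pathsum_le.
pose u := r^-1.
have u0 : 0 < u by rewrite invr_gt0.
have ru : r * u = 1 by rewrite mulfV// gt_eqF.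
have r'u : 0 <= r'^-1 <= u.
  by rewrite invr_ge0 ltW//= /u; move: eta0; rewrite /eta subr_ge0.
pose A := c * (Y / r) + phi.
(* The increment of the argument: the new step minus what the old position loses by
   renormalization. *)
pose hh x := c * (w x / r' - Y * eta).
have cosE x : c * (pathsum R d w (rcons h x) / r') + phi = A + hh x.
  by rewrite pathsum_rcons -/Y /A /hh /eta; ring.
(* As |Y| <= k and eta <= k^(-3/2), the renormalization term obeys the same bound k^(-1/2) as the
   new step. *)
have hhle x : `|hh x| <= 2 * c * u.
  rewrite normrM (ger0_norm c_ge0).
  have -> : 2 * c * u = c * (u + u) by ring.
  rewrite ler_wpM2l// (le_trans (ler_normB _ _))// lerD//.
    rewrite normrM -[leRHS]mul1r ler_pM//.
    by have /andP[? ?] := r'u; rewrite ger0_norm.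
  rewrite normrM (ger0_norm eta0).
  have -> : u = r ^+ 2 * u ^+ 3.
    by rewrite -[LHS]mul1r -[1](expr1n _ 2) -[in LHS]ru; ring.
  by rewrite ler_pM.
have trw : \sum_x erw_trans p h x * w x = (2 * r ^+ 2)^-1 * Y.
  by rewrite trans_sum_centered// ?hk// r2.
have trw2 : \sum_x erw_trans p h x * w x ^+ 2 = q + (2 * r ^+ 2)^-1 * W.
  have := trans_sum_centered R d d_gt0 h centered_sqr _ sum_centered_sqr.
  rewrite hk k0 r2 -/W => /(_ isT) <-.
  rewrite -[X in X + _](trans_sum_cst R d d_gt0 h) -big_split/=.
  by apply: eq_bigr => x _; rewrite -mulrDr /centered_sqr addrC subrK.
(* [m1] is the conditional mean of [hh], and [m2] the excess of its conditional second moment over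
   c^2 q / (k+1). *)
pose m1 := c * (Y * ((2 * r ^+ 2 * r')^-1 - eta)).
pose m2 := c ^+ 2 * (W * (2 * r ^+ 2 * r' ^+ 2)^-1 + Y ^+ 2 * (eta ^+ 2 - eta * (r ^+ 2 * r')^-1)).
have H1 : \sum_x erw_trans p h x * hh x = m1.
  transitivity (\sum_x erw_trans p h x * (- c * Y * eta + c / r' * w x + 0 * 0)).
    by apply: eq_bigr => x _; congr (_ * _); rewrite /hh; ring.
  rewrite (trans_lin R d d_gt0 h _ _ _ w (fun=> 0)) trw /m1; field.
  by rewrite !gt_eqF.
have H2 : \sum_x erw_trans p h x * hh x ^+ 2 = c ^+ 2 * q / k.+1%:R + m2.
  transitivity (\sum_x erw_trans p h x * (c ^+ 2 * Y ^+ 2 * eta ^+ 2 +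
       (- 2 * c ^+ 2 * Y * eta / r') * w x + (c ^+ 2 / r' ^+ 2) * w x ^+ 2)).
    by apply: eq_bigr => x _; congr (_ * _); rewrite /hh; field; rewrite gt_eqF.
  rewrite (trans_lin R d d_gt0 h _ _ _ w (fun x => w x ^+ 2)) trw trw2 /m2.
  have -> : k.+1%:R = r' ^+ 2 :> R by rewrite sqr_sqrtr.
  by field; rewrite !gt_eqF.
have kr' : k.+1%:R = r' ^+ 2 :> R by rewrite sqr_sqrtr.
under eq_bigr do rewrite cosE.
rewrite -/A.
have -> : \sum_x erw_trans p h x * cos (A + hh x) -
     (1 - c ^+ 2 * q / (2 * k.+1%:R)) * cos A =
  \sum_x erw_trans p h x * (cos (A + hh x) -
     (cos A - hh x * sin A - hh x ^+ 2 / 2 * cos A))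
  + (- m1 * sin A - m2 / 2 * cos A).
  under [in RHS]eq_bigr do rewrite mulrBr.
  rewrite [in RHS]sumrB -addrA; congr (_ + _).
  have -> : \sum_x erw_trans p h x * (cos A - hh x * sin A - hh x ^+ 2 / 2 * cos A) =
    \sum_x erw_trans p h x * (cos A + (- sin A) * hh x + (- 2^-1 * cos A) * hh x ^+ 2).
    by apply: eq_bigr => x _; congr (_ * _); ring.
  rewrite (trans_lin R d d_gt0 h _ _ _ hh (fun x => hh x ^+ 2)) H1 H2 kr'.
  by field; rewrite gt_eqF.
have B0 : `|\sum_x erw_trans p h x * (cos (A + hh x) -
     (cos A - hh x * sin A - hh x ^+ 2 / 2 * cos A))| <= 16 * c ^+ 3 * u ^+ 3.
  rewrite (le_trans (ler_norm_sum _ _ _))//.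
  rewrite -[leRHS](trans_sum_cst R d d_gt0 h); apply: ler_sum => x _.
  rewrite normrM ger0_norm ?erw_trans_ge0// ler_wpM2l ?erw_trans_ge0//.
  rewrite (le_trans (cos_taylor2 _ _ _))//.
  have -> : 16 * c ^+ 3 * u ^+ 3 = 2 * (2 * c * u) ^+ 3 by ring.
  by rewrite ler_pM2l// lerXn2r// nnegrE mulr_ge0// ?mulr_ge0// ltW.
have B1 : `|m1| <= c * u ^+ 3.
  rewrite /m1 normrM (ger0_norm c_ge0) ler_wpM2l// normrM.
  have -> : u ^+ 3 = r ^+ 2 * u ^+ 5.
    have -> : r ^+ 2 * u ^+ 5 = (r * u) ^+ 2 * u ^+ 3 by ring.
    by rewrite ru expr1n mul1r.
  by rewrite ler_pM.
have B2 : `|m2| <= 2 * (c ^+ 2 * (`|W| * u ^+ 4 + `|Y| * u ^+ 4)).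
  have P2 : 0 < r ^+ 2 by rewrite exprn_gt0.
  have P2' : 0 < r' ^+ 2 by rewrite exprn_gt0.
  have P3 : 0 < r ^+ 2 * r' by rewrite mulr_gt0.
  have P4 : 0 < 2 * r ^+ 2 * r' ^+ 2 by rewrite mulr_gt0// mulr_gt0.
  rewrite /m2 normrM ger0_norm ?sqr_ge0// [leRHS]mulrCA ler_wpM2l ?sqr_ge0//.
  rewrite (le_trans (ler_normD _ _))// [leRHS]mulrDr lerD//.
    rewrite normrM [leRHS]mulrCA ler_wpM2l// ger0_norm ?invr_ge0 ?(ltW P4)//.
    apply: (@le_trans _ _ (u ^+ 4)); last by rewrite ler_peMl ?exprn_ge0 ?ltW//; lra.
    rewrite exprVn lef_pV2 ?posrE ?exprn_gt0//.
    by rewrite r'2; nra.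
  (* One factor |Y| is traded for k, so that only first absolute moments are needed afterwards. *)
  have Y2 : Y ^+ 2 <= r ^+ 2 * `|Y|.
    by rewrite -(real_normK (num_real Y)) expr2 ler_wpM2r.
  have E6 : `|eta ^+ 2 - eta * (r ^+ 2 * r')^-1| <= u ^+ 6.
    have a1 : 0 <= eta ^+ 2 <= u ^+ 6.
      rewrite sqr_ge0/= (_ : u ^+ 6 = (u ^+ 3) ^+ 2); last by ring.
      by rewrite lerXn2r// nnegrE// exprn_ge0// ltW.
    have a2 : 0 <= eta * (r ^+ 2 * r')^-1 <= u ^+ 6.
      rewrite mulr_ge0 ?invr_ge0 ?(ltW P3)//=.
      rewrite (_ : u ^+ 6 = u ^+ 3 * u ^+ 3); last by ring.
      rewrite ler_pM ?invr_ge0 ?(ltW P3)//.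
      rewrite invfM -exprVn -/u [u ^+ 3]exprSr ler_wpM2l ?exprn_ge0 ?(ltW u0)//.
      by have /andP[] := r'u.
    by rewrite ler_norml; apply/andP; split; lra.
  rewrite normrM ger0_norm ?sqr_ge0//.
  apply: (@le_trans _ _ (r ^+ 2 * `|Y| * u ^+ 6)); first by rewrite ler_pM// sqr_ge0.
  have -> : r ^+ 2 * `|Y| * u ^+ 6 = (r * u) ^+ 2 * (`|Y| * u ^+ 4) by ring.
  rewrite ru expr1n mul1r ler_peMl//; last by lra.
  by rewrite mulr_ge0// exprn_ge0// ltW.
have S1 : `|- m1 * sin A| <= `|m1|.
  by rewrite normrM normrN ler_piMr// sin_max.
have S2 : `|m2 / 2 * cos A| <= `|m2| / 2.
  by rewrite normrM normrM [X in _ * X * _]ger0_norm// ler_piMr// cos_max.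
rewrite (le_trans (ler_normD _ _))//.
have := ler_normB (- m1 * sin A) (m2 / 2 * cos A).
rewrite -/u; lra.
Qed.

Variables (N : nat) (L : R).
Hypothesis L_gt0 : 0 < L.
Hypothesis harm_le : harm R N <= L ^+ 2.

Let B := c + 2 * c ^+ 2 * L + 16 * c ^+ 3.

(** In expectation both path sums are at most L sqrt k in absolute value, which turns the terms in
    k^(-2) of [charf_step_cond] into L k^(-3/2). *)
Lemma charf_step k : (0 < k)%N -> (k <= N)%N ->
  `|charf k.+1 - (1 - c ^+ 2 * q / (2 * k.+1%:R)) * charf k| <=
  B * (Num.sqrt k%:R)^-1 ^+ 3.
Proof.
move=> k0 kN; set r := Num.sqrt k%:R.
have r0 : 0 < r by rewrite sqrtr_gt0 ltr0n.
rewrite /charf erwES// -erwEZ -erwEB.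
rewrite (le_trans (ler_norm_erwE R d d_gt0 _ _ _ (fun h hk => charf_step_cond k h k0 hk)))//.
rewrite -/r erwED erwE1// erwEZ erwED.
have HL : harm R k <= L ^+ 2 by rewrite (le_trans _ harm_le)// harm_nd.
have E1 := erwE_norm_pathsum R d d_gt0 w k L k0 L_gt0 w0 w1 HL.
have E2 := erwE_norm_pathsum R d d_gt0 centered_sqr k L k0 L_gt0 sum_centered_sqr centered_sqr_le1 HL.
have EM v : erwE k (fun h => `|pathsum R d v h| * r^-1 ^+ 4) = r^-1 ^+ 4 * erwE k (fun h => `|pathsum R d v h|).
  by rewrite -erwEZ; apply: eq_erwE => h _; rewrite mulrC.
rewrite !EM.
have F v : erwE k (fun h => `|pathsum R d v h|) <= L * r ->
   r^-1 ^+ 4 * erwE k (fun h => `|pathsum R d v h|) <= L * r^-1 ^+ 3.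
  move=> H; apply: (@le_trans _ _ (r^-1 ^+ 4 * (L * r))).
    by rewrite ler_wpM2l// exprn_ge0// invr_ge0 ltW.
  by rewrite le_eqVlt; apply/orP; left; apply/eqP; field; rewrite gt_eqF.
have := F _ E1; have := F _ E2.
set a := r^-1 ^+ 4 * _; set b := r^-1 ^+ 4 * _; move=> ha hb.
have : c ^+ 2 * (a + b) <= c ^+ 2 * (2 * (L * r^-1 ^+ 3)).
  by rewrite ler_wpM2l ?sqr_ge0//; lra.
rewrite /B; lra.
Qed.

(** Both quantities are close to [cos phi]: the cosine moves by at most [c], the exponential factor
    by at most c^2. *)
Lemma charf1 : `|charf 1 - expR (- (c ^+ 2 * q / 2)) * cos phi| <= c + c ^+ 2.
Proof.
have -> : charf 1 = \sum_x erw_trans p [::] x * cos (c * w x + phi).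
  rewrite /charf erwES// erwE0; apply: eq_bigr => x _.
  by rewrite pathsum_rcons pathsum_nil add0r sqrtr1 divr1.
have h1 : `|\sum_x erw_trans p [::] x * cos (c * w x + phi) - cos phi| <= c.
  rewrite -[X in _ - X](trans_sum_cst R d d_gt0 [::]) -sumrB.
  rewrite (le_trans (ler_norm_sum _ _ _))//.
  rewrite -[leRHS](trans_sum_cst R d d_gt0 [::]); apply: ler_sum => x _.
  rewrite -mulrBr normrM ger0_norm ?erw_trans_ge0// ler_wpM2l ?erw_trans_ge0//.
  rewrite (le_trans (cos_lipschitz _ _ _))// addrK normrM (ger0_norm c_ge0).
  by rewrite ler_piMr.
have h2 : `|cos phi - expR (- (c ^+ 2 * q / 2)) * cos phi| <= c ^+ 2.
  rewrite -{1}[cos phi]mul1r -mulrBl normrM.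
  have h0 : 0 <= c ^+ 2 * q / 2.
    by rewrite divr_ge0// (mulr_ge0 (sqr_ge0 c) mean_sqr_ge0).
  have h3 := expR_ge1Dx (- (c ^+ 2 * q / 2)).
  have h4 : expR (- (c ^+ 2 * q / 2)) <= 1 by rewrite expR_le1 oppr_le0.
  rewrite -[leRHS]mulr1 ler_pM// ?cos_max// ger0_norm ?subr_ge0//.
  have : c ^+ 2 * q <= c ^+ 2 by rewrite ler_piMr ?sqr_ge0 ?mean_sqr_le1.
  by have := sqr_ge0 c; lra.
by rewrite -(subrKA (cos phi)) (le_trans (ler_normD _ _))// lerD.
Qed.

(** Replacing the factor 1 - x of each step by exp (-x) costs x^2 <= c^4 k^(-3/2), and earlier
    errors are only multiplied by exp (-x) <= 1. The errors are summed by telescoping, through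
    k^(-3/2) <= 4 (k^(-1/2) - (k+1)^(-1/2)). *)
Lemma charf_bound_rec k : (0 < k)%N -> (k <= N)%N ->
  `|charf k - expR (- (c ^+ 2 * q / 2 * harm R k)) * cos phi| <=
  c + c ^+ 2 + 4 * (B + c ^+ 4) * (1 - (Num.sqrt k%:R)^-1).
Proof.
case: k => // k _; elim: k => [|k IH] kN.
  rewrite harmS /harm big_ord0 add0r invr1 mulr1 sqrtr1 invr1 subrr mulr0 addr0.
  exact: charf1.
have {}IH := IH (ltnW kN).
set r := Num.sqrt k.+1%:R in IH; set r' := Num.sqrt k.+2%:R.
have kR : 1 <= k.+1%:R :> R by rewrite ler1n.
have r2 : r ^+ 2 = k.+1%:R by rewrite sqr_sqrtr.
have r'2 : r' ^+ 2 = r ^+ 2 + 1 by rewrite r2 sqr_sqrtr// natr1.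
have r1 : 1 <= r by rewrite -[leLHS]sqrtr1 ler_wsqrtr.
have r'0 : 0 < r' by rewrite sqrtr_gt0 ltr0n.
have [_ eta1 _] := inv_sqrt_estimates R r r' r1 r'0 r'2.
have St := charf_step k.+1 isT (ltnW kN).
set x := c ^+ 2 * q / (2 * k.+2%:R) in St.
have x0 : 0 <= x.
  by rewrite divr_ge0 ?(mulr_ge0 (sqr_ge0 c) mean_sqr_ge0)// -natrM.
have u0 : 0 < r^-1 by rewrite invr_gt0; lra.
have u1 : r^-1 <= 1 by rewrite invf_le1//; lra.
have x2 : x ^+ 2 <= c ^+ 4 * r^-1 ^+ 3.
  have xle : x <= c ^+ 2 * r^-1 ^+ 2.
    rewrite /x -mulrA ler_wpM2l ?sqr_ge0//.
    rewrite -[leRHS]mul1r ler_pM ?mean_sqr_ge0 ?mean_sqr_le1 ?invr_ge0 ?mulr_ge0//.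
    rewrite exprVn r2 lef_pV2 ?posrE ?mulr_gt0 ?ltr0n//.
    by rewrite -natrM ler_nat; lia.
  have -> : c ^+ 4 * r^-1 ^+ 3 = (c ^+ 2 * c ^+ 2) * r^-1 ^+ 3 by ring.
  apply: (@le_trans _ _ ((c ^+ 2 * r^-1 ^+ 2) ^+ 2)).
    by rewrite lerXn2r// nnegrE mulr_ge0// sqr_ge0.
  rewrite exprMn -expr2 ler_wpM2l ?sqr_ge0// -exprM.
  by rewrite ler_wiXn2l// ltW.
have E1 : `|charf k.+1| <= 1.
  rewrite -(erwE1 R d d_gt0 k.+1 1); apply: ler_norm_erwE => // h _.
  exact: cos_max.
have -> : expR (- (c ^+ 2 * q / 2 * harm R k.+2)) = expR (- x) * expR (- (c ^+ 2 * q / 2 * harm R k.+1)).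
  rewrite harmS -expRD; congr expR; rewrite /x; field.
  by rewrite -natrD pnatr_eq0.
set E := expR (- (_ * harm R k.+1)) in IH *.
have -> : charf k.+2 - expR (- x) * E * cos phi =
  (charf k.+2 - (1 - x) * charf k.+1) + (- (expR (- x) - (1 - x)) * charf k.+1) +
   expR (- x) * (charf k.+1 - E * cos phi) by ring.
have T1 : `|- (expR (- x) - (1 - x)) * charf k.+1| <= x ^+ 2.
  by rewrite normrM normrN -[leRHS]mulr1 ler_pM ?expRN_taylor1.
have T2 : `|expR (- x) * (charf k.+1 - E * cos phi)| <= `|charf k.+1 - E * cos phi|.
  by rewrite normrM ler_piMl// ger0_norm ?expR_ge0// expR_le1 oppr_le0.
rewrite (le_trans (ler_normD _ _))//.
have := ler_normD (charf k.+2 - (1 - x) * charf k.+1) (- (expR (- x) - (1 - x)) * charf k.+1).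
have Bc : 0 <= B + c ^+ 4.
  rewrite /B !addr_ge0 ?mulr_ge0 ?exprn_ge0// ltW//.
have : (B + c ^+ 4) * r^-1 ^+ 3 <= (B + c ^+ 4) * (4 * (r^-1 - r'^-1)) by rewrite ler_wpM2l.
rewrite -/r in St.
lra.
Qed.

(** The horizon enters the error only through [L]: for c of order (log N)^(-1/2) and L of order (log
    N)^(1/2) the right-hand side is O(c). *)
Lemma charf_bound : (0 < N)%N ->
  `|charf N - expR (- (c ^+ 2 * q / 2 * harm R N)) * cos phi| <=
  c + c ^+ 2 + 4 * (c + 2 * c ^+ 2 * L + 16 * c ^+ 3 + c ^+ 4).
Proof.
move=> N0; rewrite (le_trans (charf_bound_rec N N0 (leqnn _)))// lerD2l -/B.
have Bc : 0 <= 4 * (B + c ^+ 4).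
  by rewrite /B mulr_ge0// !addr_ge0 ?mulr_ge0 ?exprn_ge0// ltW.
by rewrite -[leRHS]mulr1 ler_wpM2l// lerBlDr lerDl invr_ge0 sqrtr_ge0.
Qed.

End CharacteristicFunction.

(** * Characteristic function of the one-dimensional Gaussian law *)

Section GaussianCharacteristic.
Variable R : realType.
Local Notation mu := (@lebesgue_measure R).

Lemma derivable_continuous (F : R -> R) : (forall t : R, derivable F t 1) -> continuous F.
Proof. by move=> dF t; apply/differentiable_continuous/derivable1_diffP. Qed.

(** The fundamental theorem of calculus on growing symmetric intervals, then dominated
    convergence. *)
Lemma integral_derive_vanishing (F f : R -> R) :
  (forall t : R, is_derive t 1 F (f t)) -> continuous f ->
  mu.-integrable setT (EFin \o f) ->
  F n%:R @[n --> \oo] --> 0 -> F (- n%:R) @[n --> \oo] --> 0 ->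
  Rintegral mu setT f = 0.
Proof.
move=> Ff cf intf Fp Fm.
(* The shift to [n.+1] keeps the two endpoints distinct. *)
pose A n : set R := `[(- n.+1%:R), n.+1%:R]%classic.
have FTC n : (\int[mu]_(x in A n) (f x)%:E =
    (F n.+1%:R - F (- n.+1%:R))%:E)%E.
  rewrite (@continuous_FTC2 R f F)//.
  - by rewrite gtrN// ltr0n.
  - exact: continuous_subspaceT.
  - have dF : forall t : R, derivable F t 1 by move=> t; have [] := Ff t.
    have cF := derivable_continuous F dF.
    split.
    + by move=> t _; exact: dF.
    + exact/cvg_at_right_filter/cF.
    + exact/cvg_at_left_filter/cF.
  - by move=> t _; rewrite derive1E; have [_ ->] := Ff t.
have cvgI : (\int[mu]_x (((EFin \o f) \_ (A n)) x) @[n --> \oo] --> \int[mu]_x (f x)%:E)%E.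
  apply: (@dominated_cvg _ _ _ mu setT measurableT (fun n => (EFin \o f) \_ (A n)) _
    (fun x => `|(f x)%:E|%E)).
  - move=> n; apply/(measurable_restrictT (EFin \o f)); first exact: measurable_itv.
    by apply: measurable_funTS; apply/measurable_EFinP; exact: continuous_measurable_fun.
  - move=> x _; apply: cvg_near_cst.
    near=> n; rewrite patchE mem_set// /A /= in_itv/= -ler_norml.
    near: n; exists (Num.bound `|x|) => // m /= xm.
    rewrite (le_trans (ltW (archi_boundP (normr_ge0 x))))// ler_nat.
    exact: leqW.
  - by [].
  - exact: integrable_abse.
  - move=> n x _; rewrite patchE; case: ifP => // _.
    by rewrite (_ : point = 0%E :> \bar R)// abse0 abse_ge0.
have cvg0 : (F n.+1%:R - F (- n.+1%:R))%:E @[n --> \oo] --> (0 : \bar R).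
  apply: cvg_EFin; first by near=> n.
  rewrite [X in _ --> X](_ : _ = 0 - 0); last by rewrite subr0.
  apply: cvgB.
    by rewrite (cvg_shiftS (fun n => F n%:R)).
  by rewrite (cvg_shiftS (fun n => F (- n%:R))).
rewrite /Rintegral.
have -> : (\int[mu]_x (f x)%:E = 0)%E.
  apply: (@cvg_unique _ _ _ _ _ _ cvgI) => //.
  rewrite (_ : (fun n => _) = fun n => (F n.+1%:R - F (- n.+1%:R))%:E)//.
  by apply/funext => n; rewrite -FTC [RHS]integral_mkcond.
by [].
Unshelve. all: by end_near. Qed.

Variable s : R.
Hypothesis s_gt0 : 0 < s.
Local Notation g := (normal_pdf 0 s).

Let s_neq0 : s != 0. Proof. by rewrite gt_eqF. Qed.

Lemma integrable_pdfM (h : R -> R) (M : R) : measurable_fun setT h ->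
  (forall t, `|h t| <= M) -> mu.-integrable setT (fun t => (g t * h t)%:E).
Proof.
move=> mh hM.
apply: (@le_integrable _ _ _ mu setT _ _ (fun t => (M%:E * (g t)%:E)%E)) => //.
- apply/measurable_EFinP; apply: measurable_funM => //.
  exact: measurable_normal_pdf.
- move=> t _ /=; rewrite lee_fin !normrM mulrC ler_wpM2r//.
  by rewrite (le_trans (hM t))// ler_norm.
- apply: integrableZl => //; exact: integrable_normal_pdf.
Qed.

(** Half of the Gaussian exponent absorbs the factor, by |t| <= s (1 + t^2 / (4 s^2)) <= s exp (t^2
    / (4 s^2)); the other half is the Gaussian of variance 2 s^2, and [C] also corrects the
    normalizing constant. This gives both integrability and decay at infinity. *)
Lemma le_norm_pdf : exists2 C, 0 <= C & forall t, `|t| * g t <= C * normal_pdf 0 (s * Num.sqrt 2) t.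
Proof.
have s2 : s * Num.sqrt 2 != 0 by rewrite mulf_neq0// gt_eqF// sqrtr_gt0.
exists (s * normal_peak s / normal_peak (s * Num.sqrt 2)).
  by rewrite !mulr_ge0 ?invr_ge0 ?normal_peak_ge0// ltW.
move=> t; rewrite !normal_pdfE// [leRHS]mulrA divfK; last by rewrite gt_eqF// normal_peak_gt0.
rewrite [s * _]mulrC -[leRHS]mulrA [leLHS]mulrCA ler_wpM2l ?normal_peak_ge0//.
rewrite /normal_fun subr0 exprMn sqr_sqrtr//.
have -> : - t ^+ 2 / (s ^+ 2 *+ 2) = - (t ^+ 2 / (4 * s ^+ 2)) - (t ^+ 2 / (4 * s ^+ 2)).
  by field.
have -> : - t ^+ 2 / (s ^+ 2 * 2 *+ 2) = - (t ^+ 2 / (4 * s ^+ 2)) by field.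
set a := t ^+ 2 / _; rewrite expRD mulrA ler_wpM2r ?expR_ge0//.
rewrite expRN ler_pdivrMr ?expR_gt0//.
apply: (@le_trans _ _ (s * (1 + a))); last by rewrite ler_wpM2l ?expR_ge1Dx// ltW.
rewrite -subr_ge0 /a -(real_normK (num_real t)).
have -> : s * (1 + `|t| ^+ 2 / (4 * s ^+ 2)) - `|t| = (`|t| - 2 * s) ^+ 2 / (4 * s).
  by field.
by rewrite divr_ge0 ?sqr_ge0// mulr_ge0// ltW.
Qed.

Lemma integrable_norm_pdf : mu.-integrable setT (fun t => (`|t| * g t)%:E).
Proof.
have [C C0 H] := le_norm_pdf.
apply: (@le_integrable _ _ _ mu setT _ _ (fun t => (C%:E * (normal_pdf 0 (s * Num.sqrt 2) t)%:E)%E)) => //.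
- apply/measurable_EFinP; apply: measurable_funM => //.
  exact: measurable_normal_pdf.
- move=> t _ /=; rewrite lee_fin ger0_norm ?mulr_ge0 ?normal_pdf_ge0//.
  by rewrite (le_trans (H t))// ler_norm.
- apply: integrableZl => //; apply: integrable_normal_pdf.
Qed.

Lemma is_derive_pdf (t : R) : is_derive t 1 g (- (t / s ^+ 2) * g t).
Proof.
rewrite normal_pdfE//.
rewrite /normal_fun; apply: is_derive_eq; rewrite /GRing.scale/= subr0.
by field.
Qed.

(** [b] selects the end of the line; the rate 1/n comes from [le_norm_pdf]. *)
Lemma cvg_pdf_nat (b : bool) : g ((-1) ^+ b * n%:R) @[n --> \oo] --> 0.
Proof.
have [C C0 H] := le_norm_pdf.
have s2 : s * Num.sqrt 2 != 0 by rewrite mulf_neq0// gt_eqF// sqrtr_gt0.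
pose K := C * normal_peak (s * Num.sqrt 2).
rewrite -(cvg_shiftS (fun n => g ((-1) ^+ b * n%:R))).
apply: (@squeeze_cvgr _ _ _ _ (cst 0) (fun n => K * harmonic n)).
- near=> n; rewrite normal_pdf_ge0//= ler_pdivlMr ?ltr0n// mulrC.
  have := H ((-1) ^+ b * n.+1%:R); rewrite normrM normr_sign mul1r ger0_norm//.
  by move/le_trans; apply; rewrite ler_wpM2l// normal_pdf_ub.
- exact: cvg_cst.
- rewrite [X in _ --> X](_ : _ = K * 0); last by rewrite mulr0.
  by apply: cvgMr; exact: cvg_harmonic.
Unshelve. all: by end_near. Qed.

Lemma derivable_measurable (f : R -> R) : (forall t : R, derivable f t 1) -> measurable_fun setT f.
Proof. by move=> df; apply: continuous_measurable_fun; exact: derivable_continuous. Qed.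

Lemma derivable_cos_affine (A th t : R) : derivable (fun t => cos (A + th * t)) t 1.
Proof. by apply: ex_derive. Qed.

Lemma derivable_sin_affine (A th t : R) : derivable (fun t => sin (A + th * t)) t 1.
Proof. by apply: ex_derive. Qed.

Lemma integrable_pdf_cos (A th : R) :
  mu.-integrable setT (fun t => (g t * cos (A + th * t))%:E).
Proof.
apply: (@integrable_pdfM _ 1); last by move=> t; exact: cos_max.
by apply: derivable_measurable => t; exact: derivable_cos_affine.
Qed.

Lemma integrable_pdf_sin (A th : R) :
  mu.-integrable setT (fun t => (t * g t * sin (A + th * t))%:E).
Proof.
apply: (@le_integrable _ _ _ mu setT _ _ (fun t => (`|t| * g t)%:E)) => //; last exact: integrable_norm_pdf.
- apply/measurable_EFinP; apply: measurable_funM => //.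
    by apply: measurable_funM => //; exact: measurable_normal_pdf.
  by apply: derivable_measurable => t; exact: derivable_sin_affine.
- move=> t _ /=; rewrite lee_fin !normrM normr_id (ger0_norm (normal_pdf_ge0 _ _ _)).
  by rewrite ler_piMr// ?sin_max// mulr_ge0// normal_pdf_ge0.
Qed.

Let charF (A th : R) := Rintegral mu setT (fun t => g t * cos (A + th * t)).

(** Integration by parts: the integrand [psi] is the derivative of g(t) sin (A + th t), which
    vanishes at both ends. *)
Lemma pdf_sin_integral (A th : R) :
  Rintegral mu setT (fun t => t * g t * sin (A + th * t)) = s ^+ 2 * th * charF A th.
Proof.
pose psi t := - (s ^+ 2)^-1 * (t * g t * sin (A + th * t)) + th * (g t * cos (A + th * t)).
have i1 : mu.-integrable setT (EFin \o (fun t => t * g t * sin (A + th * t))).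
  exact: integrable_pdf_sin.
have i2 : mu.-integrable setT (EFin \o (fun t => g t * cos (A + th * t))).
  exact: integrable_pdf_cos.
have i3 : mu.-integrable setT (EFin \o (fun t => - (s ^+ 2)^-1 * (t * g t * sin (A + th * t)))).
  exact: (@integrableZl _ _ _ mu setT measurableT (- (s ^+ 2)^-1) _ i1).
have i4 : mu.-integrable setT (EFin \o (fun t => th * (g t * cos (A + th * t)))).
  exact: (@integrableZl _ _ _ mu setT measurableT th _ i2).
have : Rintegral mu setT psi = 0.
  have dg (t : R) := is_derive_pdf t.
  apply: (@integral_derive_vanishing (fun t => g t * sin (A + th * t))).
  - move=> t; apply: is_derive_eq; rewrite /GRing.scale/= /psi; field.
    exact: s_neq0.
  - apply: derivable_continuous => t; rewrite /psi; apply: ex_derive.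
  - have := integrableD measurableT i3 i4.
    by apply: eq_integrable => // t _; rewrite /= EFinD.
  - apply: norm_cvg0.
    apply: (@squeeze_cvgr _ _ _ _ (cst 0) (fun n => g ((-1) ^+ false * n%:R))).
    + near=> n; rewrite normr_ge0/= expr0 mul1r normrM ger0_norm ?normal_pdf_ge0//.
      by rewrite ler_piMr ?normal_pdf_ge0// sin_max.
    + exact: cvg_cst.
    + exact: cvg_pdf_nat.
  - apply: norm_cvg0.
    apply: (@squeeze_cvgr _ _ _ _ (cst 0) (fun n => g ((-1) ^+ true * n%:R))).
    + near=> n; rewrite normr_ge0/= expr1 mulN1r normrM ger0_norm ?normal_pdf_ge0//.
      by rewrite ler_piMr ?normal_pdf_ge0// sin_max.
    + exact: cvg_cst.
    + exact: cvg_pdf_nat.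
rewrite /psi RintegralD// !RintegralZl// -/(charF A th).
set S := Rintegral _ _ _ => e.
have s2 : s ^+ 2 != 0 by rewrite sqrf_eq0.
apply: (@mulfI _ (- (s ^+ 2)^-1)); first by rewrite oppr_eq0 invr_eq0.
by rewrite (_ : - _ * (_ * _ * _) = - (th * charF A th)); [lra|field; exact: s_neq0].
Unshelve. all: by end_near. Qed.

(** Differentiation under the integral, dominated by |t| g(t), then integration by parts: a linear
    differential equation in the frequency. *)
Lemma is_derive_charF (A th : R) : is_derive th 1 (charF A) (- (s ^+ 2 * th * charF A th)).
Proof.
pose f (x t : R) := g t * cos (A + x * t).
have Ia : `]th - 1, th + 1[%classic th by rewrite /= in_itv/=; apply/andP; split; lra.
have intf x : `]th - 1, th + 1[%classic x -> mu.-integrable setT (EFin \o f x).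
  by move=> _; exact: integrable_pdf_cos.
have d1 (x t : R) : is_derive x 1 (f ^~ t) (- (t * g t * sin (A + x * t))).
  by rewrite /f; apply: is_derive_eq; rewrite /GRing.scale/=; ring.
have d1E x t : partial1of2 f x t = - (t * g t * sin (A + x * t)).
  by rewrite partial1of2E; have [_ ->] := d1 x t.
have derf1 x t : `]th - 1, th + 1[%classic x -> setT t -> derivable (f ^~ t) x 1.
  by move=> _ _; have [] := d1 x t.
have G0 (t : R) : 0 <= `|t| * g t by rewrite mulr_ge0// normal_pdf_ge0.
have Gub x t : `]th - 1, th + 1[%classic x -> setT t -> `|partial1of2 f x t| <= `|t| * g t.
  move=> _ _; rewrite d1E normrN !normrM (ger0_norm (normal_pdf_ge0 _ _ _)).
  by rewrite ler_piMr// sin_max.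
have D := @derivable_under_integral _ _ _ mu f setT measurableT th _ _ Ia intf derf1
  _ G0 integrable_norm_pdf Gub.
have E := @differentiation_under_integral _ _ _ mu f setT measurableT th _ _ Ia intf derf1
  _ G0 integrable_norm_pdf Gub.
apply: DeriveDef => //; rewrite -derive1E E -pdf_sin_integral.
under eq_Rintegral do rewrite d1E -mulN1r.
rewrite RintegralZl// ?mulN1r//; exact: integrable_pdf_sin.
Qed.

(** By the differential equation, exp (s^2 x^2 / 2) [charF A x] is constant in x. The phase [A] will
    hold the contribution of the other coordinates. *)
Lemma pdf_cos_integral (A th : R) :
  Rintegral mu setT (fun t => g t * cos (A + th * t)) =
  expR (- (s ^+ 2 * th ^+ 2 / 2)) * cos A.
Proof.
rewrite -/(charF A th).
pose K x := expR (s ^+ 2 * x ^+ 2 / 2) * charF A x.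
have dK (x : R) : is_derive x 1 K 0.
  have dc := is_derive_charF A x.
  rewrite /K; apply: is_derive_eq; rewrite /GRing.scale/=; by field.
have := @is_derive_0_is_cst _ K th 0 dK.
rewrite /K expr0n mulr0 mul0r expR0 mul1r => e.
have -> : cos A = charF A 0.
  rewrite /charF; under eq_Rintegral do rewrite mul0r addr0 mulrC.
  rewrite RintegralZl//; last exact: integrable_normal_pdf.
  by rewrite /Rintegral integral_normal_pdf//= mulr1.
by rewrite -e mulrA -expRD addNr expR0 mul1r.
Qed.

End GaussianCharacteristic.

(** * Trigonometric polynomials under iterated Gaussian integrals *)

Section TrigPolynomials.
Variables (R : realType) (d : nat).
Local Notation mu := (@lebesgue_measure R).
Local Notation rv := ('rV[R]_d).
Implicit Types (th x : rv) (a ph t : R).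

Definition dotr th x : R := \sum_i th 0 i * x 0 i.

(** Arbitrary phases make constants and sines instances of the single constructor [TrigCos], and
    Gaussian integration in one coordinate preserves its form. *)
Inductive trigpoly : (rv -> R) -> Prop :=
| TrigCos a th ph : trigpoly (fun x => a * cos (dotr th x + ph))
| TrigAdd f g : trigpoly f -> trigpoly g -> trigpoly (fun x => f x + g x).

Lemma dotrDl th th' x : dotr (th + th') x = dotr th x + dotr th' x.
Proof. by rewrite -big_split; apply: eq_bigr => i _; rewrite mxE mulrDl. Qed.

Lemma dotrNl th x : dotr (- th) x = - dotr th x.
Proof. by rewrite -sumrN; apply: eq_bigr => i _; rewrite mxE mulNr. Qed.

Lemma trigpoly_cst a : trigpoly (fun=> a).
Proof.
have -> : (fun=> a) = (fun x => a * cos (dotr 0 x + 0)).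
  apply/funext => x; rewrite addr0 /dotr big1 ?cos0 ?mulr1// => i _.
  by rewrite mxE mul0r.
exact: TrigCos.
Qed.

(** The product-to-sum formula, extended bilinearly. *)
Lemma trigpolyM f g : trigpoly f -> trigpoly g -> trigpoly (fun x => f x * g x).
Proof.
move=> tf; elim: tf g => [a th ph|f1 f2 _ IH1 _ IH2] g tg; last first.
  rewrite (_ : (fun x => _) = fun x => f1 x * g x + f2 x * g x).
    by apply: TrigAdd; [exact: IH1|exact: IH2].
  by apply/funext => x; rewrite mulrDl.
elim: tg => [a' th' ph'|g1 g2 _ IH1 _ IH2]; last first.
  rewrite (_ : (fun x => _) = fun x => a * cos (dotr th x + ph) * g1 x +
     a * cos (dotr th x + ph) * g2 x); first exact: TrigAdd.
  by apply/funext => x; rewrite mulrDr.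
rewrite (_ : (fun x => _) = fun x =>
   (a * a' / 2) * cos (dotr (th + th') x + (ph + ph')) +
   (a * a' / 2) * cos (dotr (th - th') x + (ph - ph'))).
  by apply: TrigAdd; exact: TrigCos.
apply/funext => x; rewrite !dotrDl dotrNl.
have -> : dotr th x + dotr th' x + (ph + ph') =
  (dotr th x + ph) + (dotr th' x + ph') by ring.
have -> : dotr th x - dotr th' x + (ph - ph') =
  (dotr th x + ph) - (dotr th' x + ph') by ring.
move: (dotr th x + ph) (dotr th' x + ph') => u v.
by rewrite cosD cosB; field.
Qed.

Lemma trigpoly_sum (I : Type) (r : seq I) (F : I -> rv -> R) :
  (forall i, trigpoly (F i)) -> trigpoly (fun x => \sum_(i <- r) F i x).
Proof.
move=> tF; elim: r => [|i r IH].
  by under eq_fun do rewrite big_nil; exact: trigpoly_cst.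
by under eq_fun do rewrite big_cons; exact: TrigAdd.
Qed.

Lemma trigpoly_prod (I : Type) (r : seq I) (F : I -> rv -> R) :
  (forall i, trigpoly (F i)) -> trigpoly (fun x => \prod_(i <- r) F i x).
Proof.
move=> tF; elim: r => [|i r IH].
  by under eq_fun do rewrite big_nil; exact: trigpoly_cst.
by under eq_fun do rewrite big_cons; exact: trigpolyM.
Qed.

Lemma trigpoly_sin_coord (i : 'I_d) a : trigpoly (fun x => sin (a * x 0 i)).
Proof.
have -> : (fun x => sin (a * x 0 i)) =
   fun x => 1 * cos (dotr (a *: delta_mx 0 i) x + - (pi / 2)).
  apply/funext => x; rewrite mul1r cosBpihalf; congr sin.
  rewrite /dotr (bigD1 i)//= !mxE !eqxx mulr1 big1 ?addr0// => j ji.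
  by rewrite !mxE (negbTE ji) andbF mulr0 mul0r.
exact: TrigCos.
Qed.

(** The entry of index [k] for a natural number [k], and 0 when [k] is at least [d]: the recursion
    of [gauss_iter] carries no bound on [k]. *)
Definition coef_at k th : R := \sum_(i < d | i == k :> nat) th 0 i.

Lemma dotr_set_coord k th x t :
  dotr th (set_coord x k t) = dotr (set_coord th k 0) x + coef_at k th * t.
Proof.
rewrite /dotr /coef_at mulr_suml [X in _ + X]big_mkcond -big_split/=.
apply: eq_bigr => i _; rewrite !mxE; case: ifP => _; first by rewrite mul0r add0r.
by rewrite addr0.
Qed.

Variable s : R.
Hypothesis s_gt0 : 0 < s.
Local Notation g := (normal_pdf 0 s).

Definition gauss_coord k (f : rv -> R) x : R :=
  Rintegral mu setT (fun t => g t * f (set_coord x k t)).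

Lemma gauss_iterS k f x : gauss_iter s k.+1 f x = gauss_coord k (gauss_iter s k f) x.
Proof. by []. Qed.

Lemma trigpoly_coord_measurable k f x : trigpoly f ->
  measurable_fun setT (fun t => f (set_coord x k t)).
Proof.
elim=> [a th ph|f1 f2 _ m1 _ m2]; last exact: measurable_funD.
apply: (@derivable_measurable R) => t.
under eq_fun do rewrite dotr_set_coord addrAC.
by apply: ex_derive.
Qed.

Lemma trigpoly_bounded f : trigpoly f -> exists M, forall x, `|f x| <= M.
Proof.
elim=> [a th ph|f1 f2 _ [M1 b1] _ [M2 b2]].
  by exists `|a| => x; rewrite normrM ler_piMr// cos_max.
by exists (M1 + M2) => x; rewrite (le_trans (ler_normD _ _))// lerD.
Qed.

Lemma trigpoly_coord_integrable k f x : trigpoly f ->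
  mu.-integrable setT (EFin \o (fun t => g t * f (set_coord x k t))).
Proof.
move=> tf; have [M fM] := trigpoly_bounded f tf.
have mf := trigpoly_coord_measurable k f x tf.
by apply: (integrable_pdfM R s _ M mf) => t; exact: fM.
Qed.

Lemma gauss_coordD k f1 f2 : trigpoly f1 -> trigpoly f2 ->
  gauss_coord k (fun x => f1 x + f2 x) = fun x => gauss_coord k f1 x + gauss_coord k f2 x.
Proof.
move=> t1 t2; apply/funext => x; rewrite /gauss_coord.
under eq_Rintegral do rewrite mulrDr.
by rewrite RintegralD//; exact: trigpoly_coord_integrable.
Qed.

Lemma gauss_coord_cos k a th ph : gauss_coord k (fun x => a * cos (dotr th x + ph)) =
  fun x => (a * expR (- (s ^+ 2 * coef_at k th ^+ 2 / 2))) *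
    cos (dotr (set_coord th k 0) x + ph).
Proof.
apply/funext => x; rewrite /gauss_coord.
under eq_Rintegral do rewrite mulrCA dotr_set_coord addrAC.
rewrite RintegralZl//; last exact: integrable_pdf_cos.
by rewrite pdf_cos_integral// mulrA.
Qed.

Lemma trigpoly_gauss_coord k f : trigpoly f -> trigpoly (gauss_coord k f).
Proof.
elim=> [a th ph|f1 f2 t1 g1 t2 g2]; first by rewrite gauss_coord_cos; exact: TrigCos.
by rewrite gauss_coordD//; exact: TrigAdd.
Qed.

Lemma trigpoly_gauss_iter k f : trigpoly f -> trigpoly (gauss_iter s k f).
Proof. by move=> tf; elim: k => //= k IH; exact: trigpoly_gauss_coord. Qed.

Lemma gauss_iterD k f1 f2 : trigpoly f1 -> trigpoly f2 ->
  gauss_iter s k (fun x => f1 x + f2 x) =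
  fun x => gauss_iter s k f1 x + gauss_iter s k f2 x.
Proof.
move=> t1 t2; elim: k => // k IH.
have -> : gauss_iter s k.+1 (fun x => f1 x + f2 x) = gauss_coord k (gauss_iter s k (fun x => f1 x + f2 x)) by [].
by rewrite IH gauss_coordD//; exact: trigpoly_gauss_iter.
Qed.

Definition zero_below k th : rv := \row_i (if (i < k)%N then 0 else th 0 i).

(** Each integration extracts one factor exp (- s^2 th_j^2 / 2) and erases that coordinate of the
    frequency. *)
Lemma gauss_iter_cos k a th ph : gauss_iter s k (fun x => a * cos (dotr th x + ph)) =
  fun x => (a * expR (- (s ^+ 2 / 2 * \sum_(j < k) coef_at j th ^+ 2))) *
    cos (dotr (zero_below k th) x + ph).
Proof.
elim: k => [|k IH].
  apply/funext => x /=; rewrite big_ord0 mulr0 oppr0 expR0 mulr1.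
  by congr (_ * cos (dotr _ _ + _)); apply/rowP => i; rewrite mxE.
have -> : gauss_iter s k.+1 (fun x => a * cos (dotr th x + ph)) =
  gauss_coord k (gauss_iter s k (fun x => a * cos (dotr th x + ph))) by [].
rewrite IH gauss_coord_cos; apply/funext => x.
congr (_ * cos (dotr _ _ + _)); last first.
  apply/rowP => i; rewrite !mxE.
  have -> : (i < k.+1)%N = (i == k :> nat) || (i < k)%N by rewrite ltnS leq_eqVlt.
  by case: eqP.
have -> : coef_at k (zero_below k th) = coef_at k th.
  by apply: eq_bigr => i /eqP ik; rewrite mxE ik ltnn.
rewrite -mulrA -expRD big_ord_recr/=; congr (_ * expR _); by field.
Qed.

Lemma gauss_expect_cos a th ph : gauss_expect s (fun x => a * cos (dotr th x + ph)) =
  a * expR (- (s ^+ 2 / 2 * \sum_i th 0 i ^+ 2)) * cos ph.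
Proof.
rewrite /gauss_expect gauss_iter_cos; congr (_ * expR (- (_ * _)) * cos _).
  apply: eq_bigr => j _; congr (_ ^+ 2); rewrite /coef_at.
  by rewrite (big_pred1 j).
by rewrite /dotr big1 ?add0r// => i _; rewrite mxE ltn_ord mul0r.
Qed.

Lemma norm_gauss_coord_le k f M x : trigpoly f -> (forall y, `|f y| <= M) ->
  `|gauss_coord k f x| <= M.
Proof.
move=> tf fM.
have ig : mu.-integrable setT (EFin \o (fun t => M * g t)).
  apply: (@integrableZl _ _ _ mu setT measurableT M (EFin \o g)).
  exact: integrable_normal_pdf.
rewrite (le_trans (le_normr_Rintegral _ _))//; first exact: trigpoly_coord_integrable.
apply: (@le_trans _ _ (Rintegral mu setT (fun t => M * g t))).
  apply: le_Rintegral => //.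
    have := integrable_abse (trigpoly_coord_integrable k f x tf).
    by apply: eq_integrable.
  move=> t _; rewrite normrM (ger0_norm (normal_pdf_ge0 _ _ _)) mulrC.
  by rewrite ler_wpM2r// normal_pdf_ge0.
rewrite RintegralZl//; last exact: integrable_normal_pdf.
by rewrite /Rintegral integral_normal_pdf ?gt_eqF//= mulr1.
Qed.

(* The measurability of the inner integrals of f comes for free: they are
   pointwise limits of trigonometric polynomials. *)
Lemma gauss_iter_dominated (P : nat -> rv -> R) (f : rv -> R) M k :
  (forall m, trigpoly (P m)) -> (forall m x, `|P m x| <= M) ->
  (forall x, P m x @[m --> \oo] --> f x) ->
  forall x, gauss_iter s k (P m) x @[m --> \oo] --> gauss_iter s k f x.
Proof.
move=> tP PM Pf; elim: k => // k IH x.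
have tk m : trigpoly (gauss_iter s k (P m)) by exact: trigpoly_gauss_iter.
(* Integration against a probability density keeps the bound [M], so [M * g t] dominates at every
   level. *)
have bk m y : `|gauss_iter s k (P m) y| <= M.
  elim: (k) y => [y|j IHj y]; first exact: PM.
  by rewrite gauss_iterS; apply: norm_gauss_coord_le => //; exact: trigpoly_gauss_iter.
have ig : mu.-integrable setT (EFin \o (fun t => M * g t)).
  apply: (@integrableZl _ _ _ mu setT measurableT M (EFin \o g)).
  exact: integrable_normal_pdf.
have H1 m : measurable_fun setT (fun t => (g t * gauss_iter s k (P m) (set_coord x k t))%:E).
  by have /integrableP[] := trigpoly_coord_integrable k _ x (tk m).
have H2 t : setT t -> (g t * gauss_iter s k (P m) (set_coord x k t))%:E @[m --> \oo] -->
   (g t * gauss_iter s k f (set_coord x k t))%:E.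
  move=> _; apply: cvg_EFin; first by apply: nearW.
  by apply: cvgMr; exact: IH.
have H3 m t : setT t -> (`|(g t * gauss_iter s k (P m) (set_coord x k t))%:E| <= (M * g t)%:E)%E.
  move=> _; rewrite lee_fin normrM (ger0_norm (normal_pdf_ge0 _ _ _)) mulrC.
  by rewrite ler_wpM2r// normal_pdf_ge0.
have [I _ D] := @dominated_convergence _ _ _ mu setT measurableT
  (fun m t => (g t * gauss_iter s k (P m) (set_coord x k t))%:E)
  (fun t => (g t * gauss_iter s k f (set_coord x k t))%:E)
  (EFin \o (fun t => M * g t)) H1 (emeasurable_fun_cvg _ _ H1 H2) (aeW mu H2) ig
  (aeW mu (fun t m Dt => H3 m t Dt)).
rewrite /= /Rintegral; apply: fine_cvg; rewrite fineK//.
exact: integrable_fin_num.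
Qed.

End TrigPolynomials.

(* The Bernstein operator of degree m in d variables is written as an average over
   d * m independent coin flips, so that its weights are products of
   polynomials of degree one. *)
Section CoinFlips.
Variables (R : realType) (I : finType) (y : I -> R).

(** The law of independent Bernoulli variables with parameters [y p]. *)
Definition flip_weight (om : {ffun I -> bool}) : R :=
  \prod_p (if om p then y p else 1 - y p).

Lemma sum_flip_weight : \sum_om flip_weight om = 1.
Proof.
rewrite -(bigA_distr_bigA (fun p (b : bool) => if b then y p else 1 - y p)).
by rewrite big1// => p _; rewrite big_bool/= addrC subrK.
Qed.

Definition flip_dev p (om : {ffun I -> bool}) : R := (om p)%:R - y p.

(** The product form of the weights turns the sum over outcomes into a product over flips; for
    distinct [p] and [q] the factor at [p] is the mean of a centered variable, hence 0. *)
Lemma sum_flip_dev2 p q :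
  \sum_om flip_weight om * (flip_dev p om * flip_dev q om) =
  (p == q)%:R * (y p * (1 - y p)).
Proof.
pose F r (b : bool) := (if b then y r else 1 - y r) *
  ((if r == p then b%:R - y r else 1) * (if r == q then b%:R - y r else 1)).
transitivity (\sum_(om : {ffun I -> bool}) \prod_r F r (om r)).
  apply: eq_bigr => om _; rewrite !big_split/= /flip_weight; congr (_ * (_ * _)).
    by rewrite -big_mkcond big_pred1_eq.
  by rewrite -big_mkcond big_pred1_eq.
rewrite -(bigA_distr_bigA F) (bigD1 p)//= big_bool /F/= eqxx.
have [<-|pq] := eqVneq p q.
  rewrite big1 ?mulr1 ?mul1r; first by rewrite sub0r; ring.
  by move=> r rp; rewrite big_bool/= (negbTE rp); ring.
rewrite (_ : _ + _ * (_ * _) = 0); last by ring.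
by rewrite !mul0r.
Qed.

Hypothesis y01 : forall p, 0 <= y p <= 1.

Lemma flip_weight_ge0 om : 0 <= flip_weight om.
Proof.
apply: prodr_ge0 => p _; have /andP[y0 y1] := y01 p.
by case: ifP; rewrite ?subr_ge0.
Qed.

End CoinFlips.

(** * Empirical frequencies of the flips *)

Section BernsteinNodes.
Variables (R : realType) (d m : nat) (y : 'I_d -> R).
Hypothesis y01 : forall i, 0 <= y i <= 1.
Local Notation Om := {ffun 'I_d * 'I_m.+1 -> bool}.
Local Notation wt := (flip_weight R _ (fun p : 'I_d * 'I_m.+1 => y p.1)).

Definition flip_freq (om : Om) i : R := m.+1%:R^-1 * \sum_(j < m.+1) (om (i, j))%:R.

(** After expanding the square only the diagonal terms survive, each with variance at most 1. *)
Lemma flip_freq_variance i : \sum_(om : Om) wt om * (flip_freq om i - y i) ^+ 2 <= m.+1%:R^-1.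
Proof.
have m0 : 0 < m.+1%:R :> R by rewrite ltr0n.
have -> : \sum_(om : Om) wt om * (flip_freq om i - y i) ^+ 2 =
  (\sum_(om : Om) \sum_(j < m.+1) \sum_(j' < m.+1) m.+1%:R^-1 ^+ 2 *
   (wt om * (flip_dev R _ (fun p => y p.1) (i, j) om * flip_dev R _ (fun p => y p.1) (i, j') om))).
  apply: eq_bigr => om _.
  have -> : flip_freq om i - y i = m.+1%:R^-1 * \sum_(j < m.+1) flip_dev R _ (fun p => y p.1) (i, j) om.
    rewrite /flip_dev/= sumrB sumr_const card_ord mulrBr -[y i *+ _]mulr_natl mulKf// gt_eqF//.
  rewrite exprMn mulrCA [X in _ * (_ * X)]expr2 mulr_suml !mulr_sumr.
  by apply: eq_bigr => j _; rewrite !mulr_sumr.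
rewrite exchange_big/=; under eq_bigr do rewrite exchange_big/=.
under eq_bigr do under eq_bigr do rewrite -mulr_sumr sum_flip_dev2.
apply: (@le_trans _ _ (\sum_(j < m.+1) m.+1%:R^-1 ^+ 2)); last first.
  by rewrite sumr_const card_ord -[_ ^+ 2 *+ _]mulr_natl expr2 mulrA mulfV ?mul1r// gt_eqF.
apply: ler_sum => j _; rewrite (bigD1 j)//= eqxx mul1r big1 ?addr0; last first.
  by move=> j' jj'; rewrite xpair_eqE eqxx/= eq_sym (negbTE jj') mul0r mulr0.
rewrite ler_piMr ?sqr_ge0//; have /andP[] := y01 i; nra.
Qed.

End BernsteinNodes.

(** * Uniform continuity near a compact set *)

Section Heine.
Variables (R : realType) (T : pseudoMetricType R) (K : set T) (g : T -> R).
Hypothesis cK : compact K.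
Hypothesis cg : forall x, K x -> {for x, continuous g}.

(** Only one of the two points has to lie in [K]: the Bernstein nodes may leave the cube. *)
Lemma compact_uniform_continuity (e : R) : 0 < e ->
  exists2 del : R, 0 < del & forall y z, K y -> ball y del z -> `|g y - g z| < e.
Proof.
move=> e0; have e20 : 0 < e / 2 by rewrite divr_gt0.
have := cK; rewrite compact_near_coveringP.
move=> /(_ _ (0^'+ : set_system R) (fun del y => forall z, ball y del z -> `|g y - g z| < e)).
case.
  move=> x Kx.
  have /cvgrPdist_lt /(_ _ e20) /nbhs_ballP[r /= r0 H] := cg x Kx.
  have r20 : 0 < r / 2 by rewrite divr_gt0.
  near=> y del => z yz.
  have xy : ball x (r / 2) y by near: y; exact: nbhsx_ballx.
  have dr : del <= r / 2 by near: del; apply: nbhs_right_le.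
  have h1 : `|g x - g y| < e / 2.
    by apply: H; apply: le_ball xy; lra.
  have h2 : `|g x - g z| < e / 2.
    apply: H; rewrite (splitr r); apply: ball_triangle xy _.
    exact: le_ball yz.
  rewrite -(subrKA (g x)) (le_lt_trans (ler_normD _ _))// (distrC _ (g x)).
  by rewrite (splitr e) ltrD.
move=> del /= del0 H.
exists (del / 2); first by rewrite divr_gt0.
move=> y z Ky yz; apply: (H (del / 2)) => //=; last by rewrite divr_gt0.
by rewrite sub0r normrN gtr0_norm ?divr_gt0//; lra.
Unshelve. all: by end_near. Qed.

End Heine.

(** * Uniform approximation on cubes by trigonometric polynomials *)

Section TrigApprox.
Variables (R : realType) (d : nat).
Local Notation rv := ('rV[R]_d).

(* asin is only known to be continuous on the open interval ]-1, 1[; the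
   truncation at 1/2 makes the inverse of sin uniformly continuous on the line. *)
Definition clamp (z : R) : R := (`|z + 2^-1| - `|z - 2^-1|) / 2.

Lemma clamp_id z : `|z| <= 2^-1 -> clamp z = z.
Proof.
rewrite ler_norml => /andP[z1 z2]; rewrite /clamp ger0_norm; last by lra.
by rewrite ler0_norm; lra.
Qed.

Lemma clamp_le z : `|clamp z| <= 2^-1.
Proof.
rewrite /clamp normrM [X in _ * X]ger0_norm ?invr_ge0// ler_piMl//.
by rewrite (le_trans (ler_dist_dist _ _))// (_ : _ - _ = 1) ?normr1//; field.
Qed.

Lemma clamp_lip a b : `|clamp a - clamp b| <= `|a - b|.
Proof.
have -> : clamp a - clamp b =
  ((`|a + 2^-1| - `|b + 2^-1|) + (`|b - 2^-1| - `|a - 2^-1|)) / 2.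
  by rewrite /clamp; field.
rewrite normrM [X in _ * X]ger0_norm ?invr_ge0// ler_pdivrMr// mulr_natr mulr2n.
rewrite (le_trans (ler_normD _ _))// lerD//.
  by rewrite (le_trans (ler_dist_dist _ _))// (_ : _ - _ = a - b)//; ring.
by rewrite (le_trans (ler_dist_dist _ _))// distrC (_ : _ - _ = a - b)//; ring.
Qed.

Lemma asin_clamp_unif (e : R) : 0 < e -> exists2 del, 0 < del &
  forall a b, `|a - b| < del -> `|asin (clamp a) - asin (clamp b)| < e.
Proof.
move=> e0.
have cK : compact (`[(- 2^-1), 2^-1]%classic : set R) by exact: segment_compact.
have ca (x : R) : `[(- 2^-1), 2^-1]%classic x -> {for x, continuous (@asin R)}.
  rewrite /= in_itv/= => /andP[x1 x2].
  by apply: continuous_asin; apply/andP; split; lra.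
have [del del0 H] := @compact_uniform_continuity R R _ _ cK ca e e0.
exists del => // a b ab; apply: H; first by rewrite /= in_itv/= -ler_norml clamp_le.
exact: le_lt_trans (clamp_lip a b) ab.
Qed.

Variables (f : rv -> R) (M : R).
Hypothesis fcont : continuous f.
Hypothesis fM : forall x, `|f x| <= M.

(** [P x] is the mean of [f] at a random node: coordinate i flips m + 1 coins of bias (1 + sin (x_i
    / (2T))) / 2, and [rho] maps their frequency back to a coordinate. The weights are polynomials
    in these sines, an average keeps the bound [M], and Chebyshev's inequality gives the error. *)
Lemma trigpoly_approx (T e : R) : 0 < T -> 0 < e ->
  exists P, [/\ trigpoly R d P, forall x, `|P x| <= M &
    forall x : rv, (forall i, `|x 0 i| <= T) -> `|f x - P x| <= e].
Proof.
move=> T0 e0.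
have e20 : 0 < e / 2 by rewrite divr_gt0.
have M0 : 0 <= M by rewrite (le_trans _ (fM 0)).
have T20 : 0 < 2 * T by rewrite mulr_gt0.
have M20 : 0 <= 4 * (2 * M) by rewrite !mulr_ge0.
pose K : set rv := [set v | forall i, `[(- T), T]%classic (v ord0 i)].
have cK : compact K.
  by apply: (@rV_compact _ _ (fun=> `[(- T), T]%classic)) => i; exact: segment_compact.
have [del1 del10 H1] := @compact_uniform_continuity R rv K f cK (fun x _ => fcont x) _ e20.
have [del del0 H2] := asin_clamp_unif (del1 / (2 * T)) (divr_gt0 del10 T20).
pose rho z := 2 * T * asin (clamp z).
(* The Chebyshev error: [d] coordinates of variance at most 1/(m+1), each allowed a deviation
   [del / 2], where [f] can be off by 2M. *)
have [m mlt] : exists m, 4 * (2 * M) * d%:R / del ^+ 2 * m.+1%:R^-1 <= e / 2.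
  pose C := 4 * (2 * M) * d%:R / del ^+ 2.
  have C0 : 0 <= C / (e / 2) by rewrite !mulr_ge0 ?invr_ge0 ?sqr_ge0// ltW.
  exists (Num.bound (C / (e / 2))); rewrite -/C ler_pdivrMr ?ltr0n// -ler_pdivrMl//.
  by rewrite mulrC (le_trans (ltW (archi_boundP C0)))// ler_nat.
pose Y (x : rv) i := (1 + sin ((2 * T)^-1 * x 0 i)) / 2.
pose node (om : {ffun 'I_d * 'I_m.+1 -> bool}) : rv := \row_i rho (2 * flip_freq R d m om i - 1).
pose wt x := flip_weight R _ (fun p : 'I_d * 'I_m.+1 => Y x p.1).
pose P x := \sum_om wt x om * f (node om).
have Y01 x i : 0 <= Y x i <= 1.
  have := sin_geN1 ((2 * T)^-1 * x 0 i); have := sin_le1 ((2 * T)^-1 * x 0 i).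
  by rewrite /Y => *; apply/andP; split; lra.
have wt0 x om : 0 <= wt x om by apply: flip_weight_ge0 => p; exact: Y01.
have wt1 x : \sum_om wt x om = 1 by exact: sum_flip_weight.
exists P; split.
- rewrite /P; apply: trigpoly_sum => om; apply: trigpolyM; last exact: trigpoly_cst.
  rewrite /wt /flip_weight; apply: trigpoly_prod => p.
  have tY : trigpoly R d (fun x => Y x p.1).
    rewrite /Y; apply: trigpolyM; last exact: trigpoly_cst.
    by apply: TrigAdd; [exact: trigpoly_cst|exact: trigpoly_sin_coord].
  case: (om p) => //; apply: TrigAdd; first exact: trigpoly_cst.
  rewrite (_ : (fun x => - Y x p.1) = fun x => -1 * Y x p.1); last first.
    by apply/funext => x; rewrite mulN1r.
  by apply: trigpolyM => //; exact: trigpoly_cst.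
- move=> x; rewrite /P (le_trans (ler_norm_sum _ _ _))//.
  rewrite -[leRHS]mul1r -(wt1 x) mulr_suml; apply: ler_sum => om _.
  by rewrite normrM ger0_norm// ler_wpM2l.
move=> x xT.
have fx : f x = \sum_om wt x om * f x by rewrite -mulr_suml wt1 mul1r.
rewrite fx /P -sumrB (le_trans (ler_norm_sum _ _ _))//.
(* Either all frequencies are within [del / 2] of their means and [f] moves by at most [e / 2], or
   some squared deviation is at least del^2 / 4 and pays for the trivial bound 2M. *)
have pw om : `|wt x om * f x - wt x om * f (node om)| <=
  wt x om * (e / 2) + 4 * (2 * M) / del ^+ 2 *
    \sum_i wt x om * (flip_freq R d m om i - Y x i) ^+ 2.
  have -> : wt x om * (e / 2) + 4 * (2 * M) / del ^+ 2 *
      \sum_i wt x om * (flip_freq R d m om i - Y x i) ^+ 2 =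
    wt x om * (e / 2 + 4 * (2 * M) / del ^+ 2 *
      \sum_i (flip_freq R d m om i - Y x i) ^+ 2) by rewrite -mulr_sumr; ring.
  rewrite -mulrBr normrM ger0_norm//; apply: ler_wpM2l => //.
  have S0 : 0 <= \sum_(i < d) (flip_freq R d m om i - Y x i) ^+ 2.
    by apply: sumr_ge0 => i _; exact: sqr_ge0.
  have C0 : 0 <= 4 * (2 * M) / del ^+ 2 by rewrite divr_ge0 ?sqr_ge0.
  have [/forallP near|] := boolP [forall i, `|2 * (flip_freq R d m om i - Y x i)| < del].
    apply: (@le_trans _ _ (e / 2)); last by rewrite lerDl mulr_ge0.
    apply/ltW/H1; first by move=> i; rewrite /= in_itv/= -ler_norml (xT i).
    split=> // i j; rewrite ord1 /node mxE /ball/=.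
    (* On the cube |x_j / (2T)| <= 1/2, so the sine stays in the range where [clamp] is the
       identity. *)
    have -> : x 0 j = rho (sin ((2 * T)^-1 * x 0 j)).
      have h : `|(2 * T)^-1 * x 0 j| <= 2^-1.
        rewrite normrM ger0_norm ?invr_ge0 ?(ltW T20)// invfM -mulrA ler_piMr//.
        by rewrite mulrC ler_pdivrMr// mul1r.
      have hs : `|sin ((2 * T)^-1 * x 0 j)| <= 2^-1.
        by apply: le_trans h; exact: norm_sin_le.
      rewrite /rho clamp_id// sinK; first by rewrite mulrA mulfV ?mul1r// gt_eqF.
      rewrite in_itv/= -ler_norml (le_trans h)//; have := @pi_ge2 R; lra.
    rewrite /rho -mulrBr normrM (gtr0_norm T20) -ltr_pdivlMl// [ltRHS]mulrC.
    apply: H2; rewrite distrC (_ : _ - _ = 2 * (flip_freq R d m om j - Y x j)) ?near//.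
    by rewrite /Y; field.
  rewrite negb_forall => /existsP[i]; rewrite -leNgt => far.
  apply: (@le_trans _ _ (2 * M)).
    by rewrite (le_trans (ler_normB _ _))// mulr_natl mulr2n lerD.
  have S1 : (flip_freq R d m om i - Y x i) ^+ 2 <=
     \sum_(i < d) (flip_freq R d m om i - Y x i) ^+ 2.
    by rewrite (bigD1 i)//= lerDl sumr_ge0// => j _; exact: sqr_ge0.
  have far2 : del ^+ 2 <= 4 * (flip_freq R d m om i - Y x i) ^+ 2.
    rewrite (_ : 4 * _ = `|2 * (flip_freq R d m om i - Y x i)| ^+ 2).
      by rewrite lerXn2r// nnegrE ltW.
    by rewrite real_normK ?num_real//; ring.
  have del20 : 0 < del ^+ 2 by rewrite exprn_gt0.
  set S := \sum_(i < d) _ in S0 S1 *.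
  have -> : 4 * (2 * M) / del ^+ 2 * S = (2 * M) * (4 * S / del ^+ 2) by ring.
  apply: (@le_trans _ _ (2 * M * (4 * S / del ^+ 2))); last by rewrite lerDr ltW.
  rewrite ler_peMr ?mulr_ge0// ler_pdivlMr// mul1r; lra.
apply: (le_trans (ler_sum _ (fun om _ => pw om))).
rewrite big_split/= -mulr_suml wt1 mul1r -mulr_sumr exchange_big/=.
rewrite [leRHS]splitr lerD2l (le_trans _ mlt)//.
have -> : 4 * (2 * M) * d%:R / del ^+ 2 * m.+1%:R^-1 =
   4 * (2 * M) / del ^+ 2 * (d%:R * m.+1%:R^-1) by ring.
rewrite ler_wpM2l ?divr_ge0 ?sqr_ge0//.
rewrite -[d in leRHS]card_ord mulr_natl -sumr_const; apply: ler_sum => i _.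
by apply: flip_freq_variance => j; exact: Y01.
Qed.

End TrigApprox.

(** * Harmonic numbers and the logarithm *)

Section HarmonicLog.
Variable R : realType.

Lemma cvg_dist_cvg0 (f g e : nat -> R) (l : R) :
  (\forall n \near \oo, `|f n - g n| <= e n) -> e n @[n --> \oo] --> 0 ->
  g n @[n --> \oo] --> l -> f n @[n --> \oo] --> l.
Proof.
move=> fg /cvgrPdist_le e0 /cvgrPdist_le gl; apply/cvgrPdist_le => eps eps0.
have eps20 : 0 < eps / 2 by rewrite divr_gt0.
have H1 := e0 _ eps20; have H2 := gl _ eps20.
near=> n.
have h0 : `|f n - g n| <= e n by near: n; exact: fg.
have h1 : `|0 - e n| <= eps / 2 by near: n; exact: H1.
have h2 : `|l - g n| <= eps / 2 by near: n; exact: H2.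
rewrite -(subrKA (g n)) [leRHS]splitr (le_trans (ler_normD _ _))// lerD//.
rewrite distrC (le_trans h0)// (le_trans _ h1)// sub0r normrN ler_norm//.
Unshelve. all: by end_near. Qed.

(** Summation of ln (1 + x) <= x at x = 1/(n+1). *)
Lemma ln_le_harm n : ln n.+1%:R <= harm R n.
Proof.
elim: n => [|n IH]; first by rewrite ln1 /harm big_ord0.
rewrite harmS.
have n0 : 0 < n.+1%:R :> R by rewrite ltr0n.
have -> : n.+2%:R = n.+1%:R * (1 + n.+1%:R^-1) :> R.
  by rewrite mulrDr mulr1 mulfV ?gt_eqF// natr1.
have i0 : 0 < n.+1%:R^-1 :> R by rewrite invr_gt0.
have i2 : 0 < 1 + n.+1%:R^-1 :> R by rewrite addr_gt0.
have i3 : -1 < n.+1%:R^-1 :> R by rewrite (lt_trans _ i0)// oppr_lt0.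
by rewrite lnM ?posrE// lerD// le_ln1Dx.
Qed.

(** Summation of ln (1 + x) <= x at x = -1/(n+2). *)
Lemma harm_le_ln n : harm R n.+1 <= 1 + ln n.+1%:R.
Proof.
elim: n => [|n IH]; first by rewrite harmS /harm big_ord0 add0r invr1 ln1 addr0.
rewrite harmS.
have n0 : 0 < n.+1%:R :> R by rewrite ltr0n.
have n20 : 0 < n.+2%:R :> R by rewrite ltr0n.
have i1 : n.+2%:R^-1 < 1 :> R by rewrite invf_lt1// ltr1n.
have e : n.+1%:R = n.+2%:R * (1 - n.+2%:R^-1) :> R.
  by rewrite mulrBr mulr1 mulfV ?gt_eqF// -(natr1 n.+1) addrK.
have i2 : 0 < 1 - n.+2%:R^-1 :> R by rewrite subr_gt0.
have := IH; rewrite e lnM ?posrE//.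
have := @le_ln1Dx R (- n.+2%:R^-1); rewrite ltrN2 => /(_ i1) h1 h2.
by rewrite -lerBrDr (le_trans h2)// -addrA !lerD2l.
Qed.

Lemma ln_nat_dvg (A : R) : \forall n \near \oo, A <= ln n%:R.
Proof.
exists (Num.bound (expR A)) => // n /= nA.
have h : expR A <= n%:R.
  by rewrite (le_trans (ltW (archi_boundP (expR_ge0 A))))// ler_nat.
by rewrite -[A]expRK ler_ln ?posrE ?expR_gt0// (lt_le_trans (expR_gt0 A)).
Qed.

(* Equal to 0 for n <= 1. *)
Definition inv_sqrt_ln (n : nat) : R := (Num.sqrt (ln n%:R))^-1.

Lemma inv_sqrt_ln_cvg0 : inv_sqrt_ln n @[n --> \oo] --> 0.
Proof.
apply/cvgrPdist_le => e e0.
have H := ln_nat_dvg (e^-1 ^+ 2).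
near=> n; rewrite sub0r normrN ger0_norm ?invr_ge0 ?sqrtr_ge0//.
have h : e^-1 ^+ 2 <= ln n%:R by near: n; exact: H.
rewrite -[e]invrK lef_pV2 ?posrE ?invr_gt0 ?sqrtr_gt0//; last first.
  by rewrite (lt_le_trans _ h)// exprn_gt0// invr_gt0.
rewrite -(ger0_norm (ltW (_ : 0 < e^-1))) ?invr_gt0// -sqrtr_sqr.
exact: ler_wsqrtr.
Unshelve. all: by end_near. Qed.

Lemma harm_div_ln_cvg : harm R n / ln n%:R @[n --> \oo] --> (1 : R).
Proof.
have H := ln_nat_dvg 1.
(* The upper bound is 1 + 1 / ln n, written so that [inv_sqrt_ln_cvg0] applies. *)
apply: (@squeeze_cvgr _ _ _ _ (cst 1) (fun n => 1 + inv_sqrt_ln n * inv_sqrt_ln n)).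
- near=> n; have h : 1 <= ln n%:R :> R by near: n; exact: H.
  have l0 : 0 < ln n%:R :> R by lra.
  have n1 : (0 < n)%N by near: n; exact: nbhs_infty_gt.
  rewrite -(prednK n1) in h l0 *; move: (n.-1) h l0 => k h l0.
  rewrite ler_pdivlMr// mul1r ler_pdivrMr//; apply/andP; split.
    rewrite (le_trans _ (ln_le_harm k.+1))// ler_ln ?posrE ?ltr0n//.
    by rewrite ler_nat.
  rewrite mulrDl mul1r /inv_sqrt_ln -invfM -expr2 sqr_sqrtr ?(ltW l0)// mulVf ?gt_eqF//.
  by rewrite addrC harm_le_ln.
- exact: cvg_cst.
- rewrite [X in _ --> X](_ : _ = 1 + 0 * 0); last by rewrite mulr0 addr0.
  apply: cvgD; first exact: cvg_cst.
  by apply: cvgM; exact: inv_sqrt_ln_cvg0.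
Unshelve. all: by end_near. Qed.

End HarmonicLog.

(** * Projections of the center of mass and passage to the limit *)

Section Projections.
Variables (R : realType) (d : nat).
Hypothesis d_gt0 : (0 < d)%N.
Local Notation rv := ('rV[R]_d).
Local Notation dir := (dir d).
Local Notation erwE := (@erwE R d).
Implicit Types (th x : rv).

Lemma dotrDr th x y : dotr R d th (x + y) = dotr R d th x + dotr R d th y.
Proof. by rewrite -big_split; apply: eq_bigr => i _; rewrite mxE mulrDr. Qed.

Lemma dotrZr th a x : dotr R d th (a *: x) = a * dotr R d th x.
Proof. by rewrite mulr_sumr; apply: eq_bigr => i _; rewrite mxE mulrCA. Qed.

Lemma dotr0r th : dotr R d th 0 = 0.
Proof. by rewrite /dotr big1// => i _; rewrite mxE mulr0. Qed.

Lemma dotr_sumr th (I : Type) (r : seq I) (F : I -> rv) :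
  dotr R d th (\sum_(i <- r) F i) = \sum_(i <- r) dotr R d th (F i).
Proof. by elim/big_rec2: _ => [|i x y _ <-]; rewrite ?dotr0r ?dotrDr. Qed.

Definition proj_step th (e : dir) : R := dotr R d th (dvec R e).

Lemma proj_stepE th i b : proj_step th (i, b) = (if b then 1 else -1) * th 0 i.
Proof.
rewrite /proj_step /dvec dotrZr/=; congr (_ * _).
rewrite /dotr (bigD1 i)//= !mxE !eqxx mulr1 big1 ?addr0// => j ji.
by rewrite !mxE (negbTE ji) andbF mulr0.
Qed.

Definition scaled_center (n : nat) (h : seq dir) : rv :=
  (Num.sqrt (n%:R * ln n%:R))^-1 *: erw_center R n h.

Lemma dotr_scaled_center th n h : size h = n -> dotr R d th (scaled_center n h) =
  (Num.sqrt (n%:R * ln n%:R))^-1 * (n%:R^-1 * possum R d (proj_step th) h).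
Proof.
move=> hn; rewrite /scaled_center !dotrZr; congr (_ * (_ * _)).
rewrite dotr_sumr /possum hn; apply: eq_bigr => k _.
by rewrite /erw_pos dotr_sumr.
Qed.

(** * Cosine limit for a fixed frequency *)

Section Scaled.
Variables (th : rv) (K : R).
Hypothesis K_gt0 : 0 < K.
Hypothesis thK : forall i, `|th 0 i| <= K.

(** Division by [K] brings the steps into [-1, 1], as the moment bounds require; [K] comes back in
    the parameter [c] of [charf]. *)
Let w e := K^-1 * proj_step th e.

Lemma sum_scaled_step : \sum_e w e = 0.
Proof.
rewrite -mulr_sumr -(pair_big xpredT xpredT (fun i b => proj_step th (i, b)))/=.
rewrite big1 ?mulr0// => i _; by rewrite big_bool !proj_stepE /=; ring.
Qed.

Lemma norm_scaled_step_le1 e : `|w e| <= 1.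
Proof.
case: e => i b; rewrite /w proj_stepE normrM gtr0_norm ?invr_gt0// ler_pdivrMl// mulr1.
by rewrite normrM (_ : `|_| = 1) ?mul1r//; case: b; rewrite ?normrN normr1.
Qed.

Lemma mean_sqr_scaled_step : mean_sqr R d w = K^-1 ^+ 2 * (d%:R^-1 * \sum_i th 0 i ^+ 2).
Proof.
have d0 := dR_gt0 R d d_gt0.
rewrite /mean_sqr -(pair_big xpredT xpredT (fun i b => w (i, b) ^+ 2))/=.
have -> : \sum_i \sum_j w (i, j) ^+ 2 = 2 * K^-1 ^+ 2 * \sum_i th 0 i ^+ 2.
  rewrite mulr_sumr; apply: eq_bigr => i _.
  by rewrite big_bool /w !proj_stepE /=; ring.
by rewrite natrM; field; rewrite !gt_eqF.
Qed.

Lemma possum_proj h : possum R d (proj_step th) h = K * possum R d w h.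
Proof.
rewrite /possum mulr_sumr; apply: eq_bigr => k _.
rewrite /pathsum mulr_sumr; apply: eq_bigr => e _.
by rewrite /w mulrA mulfV ?mul1r// gt_eqF.
Qed.

Variable phi : R.

(** The sum of positions is the martingale [D] plus (2n+1)/3 times the position. After scaling, [D]
    contributes at most [K * inv_sqrt_ln R n], the summand 1/3 a third of that, and 2n/3 gives the
    factor 2/3 in [charf]. *)
Lemma charf_center n : (1 < n)%N ->
  `|erwE n (fun h => cos (dotr R d th (scaled_center n h) + phi)) -
    charf R d w (2 / 3 * K * inv_sqrt_ln R n) phi n| <= 2 * K * inv_sqrt_ln R n.
Proof.
move=> n1; have nR : 1 < n%:R :> R by rewrite ltr1n.
have n0 : 0 < n%:R :> R by lra.
have l0 : 0 < ln n%:R :> R by rewrite ln_gt0.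
pose r : R := Num.sqrt n%:R.
have r0 : 0 < r by rewrite sqrtr_gt0.
have r2 : r ^+ 2 = n%:R by rewrite sqr_sqrtr// ltW.
have r1 : 1 <= r by rewrite -[leLHS]sqrtr1 ler_wsqrtr// ltW.
have u0 : 0 < inv_sqrt_ln R n by rewrite invr_gt0 sqrtr_gt0.
rewrite /charf -erwEB.
pose D h := possum R d w h - (2 * n%:R + 1) / 3 * pathsum R d w h.
have ED : erwE n (fun h => `|D h|) <= r * n%:R.
  apply: erwE_norm_le_sqr => //; first by rewrite mulr_gt0.
  rewrite (le_trans (erwE_possum_mart_sqr R d d_gt0 w n sum_scaled_step norm_scaled_step_le1))//.
  by rewrite exprMn r2 -exprS.
apply: (@le_trans _ _ (erwE n (fun h => K * inv_sqrt_ln R n * r^-1 * n%:R^-1 * `|D h| + K * inv_sqrt_ln R n / 3))).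
  apply: ler_norm_erwE => // h hn.
  rewrite (le_trans (cos_lipschitz _ _ _))//.
  rewrite dotr_scaled_center// possum_proj sqrtrM ?(ltW n0)// invfM -/r -/(inv_sqrt_ln R n).
  have -> : r^-1 * inv_sqrt_ln R n * (n%:R^-1 * (K * possum R d w h)) + phi -
      (2 / 3 * K * inv_sqrt_ln R n * (pathsum R d w h / r) + phi) =
    K * inv_sqrt_ln R n * r^-1 * n%:R^-1 * D h + K * inv_sqrt_ln R n / 3 * (r^-1 * (n%:R^-1 * pathsum R d w h)).
    by rewrite /D; field; rewrite !gt_eqF.
  have A0 : 0 <= K * inv_sqrt_ln R n * r^-1 * n%:R^-1.
    by rewrite !mulr_ge0 ?invr_ge0// ltW.
  have B0 : 0 <= K * inv_sqrt_ln R n / 3 by rewrite !mulr_ge0// ltW.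
  rewrite (le_trans (ler_normD _ _))// lerD//; first by rewrite normrM ger0_norm.
  rewrite normrM (ger0_norm B0) ler_piMr// normrM gtr0_norm ?invr_gt0//.
  rewrite ler_pdivrMl// mulr1 (le_trans _ r1)// normrM gtr0_norm ?invr_gt0//.
  by rewrite ler_pdivrMl// mulr1 -hn norm_pathsum_le//; exact: norm_scaled_step_le1.
rewrite erwED erwEZ erwE1//.
have A0 : 0 <= K * inv_sqrt_ln R n * r^-1 * n%:R^-1 by rewrite !mulr_ge0 ?invr_ge0// ltW.
have := ler_wpM2l A0 ED.
have -> : K * inv_sqrt_ln R n * r^-1 * n%:R^-1 * (r * n%:R) = K * inv_sqrt_ln R n.
  by field; rewrite !gt_eqF.
have : 0 < K * inv_sqrt_ln R n by rewrite mulr_gt0.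
lra.
Qed.

Lemma charf_center_cvg :
  erwE n (fun h => cos (dotr R d th (scaled_center n h) + phi)) @[n --> \oo] -->
  expR (- (4 / (9 * d)%:R / 2 * \sum_i th 0 i ^+ 2)) * cos phi.
Proof.
have d0 := dR_gt0 R d d_gt0.
pose ka := 2 / 3 * K.
have ka0 : 0 < ka by rewrite !mulr_gt0.
pose q := mean_sqr R d w.
pose E n := expR (- (ka ^+ 2 * q / 2 * (harm R n / ln n%:R))) * cos phi.
(* The terms of [charf_center] and [charf_bound], with every power of u = [inv_sqrt_ln R n] <= 1
   bounded by u; 4 ka^2 comes from 2 c^2 L = 2 ka^2 (u^2 + u). *)
pose C := 2 * K + ka + ka ^+ 2 + 4 * (ka + 4 * ka ^+ 2 + 16 * ka ^+ 3 + ka ^+ 4).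
have EL : E n @[n --> \oo] --> expR (- (4 / (9 * d)%:R / 2 * \sum_i th 0 i ^+ 2)) * cos phi.
  have -> : 4 / (9 * d)%:R / 2 * \sum_i th 0 i ^+ 2 = ka ^+ 2 * q / 2 * 1.
    by rewrite /q mean_sqr_scaled_step /ka natrM; field; rewrite !gt_eqF.
  apply: cvgMl; apply: (cvg_comp _ expR); last exact: continuous_expR.
  by apply: cvgN; apply: cvgMr; exact: harm_div_ln_cvg.
have B0 : C * inv_sqrt_ln R n @[n --> \oo] --> 0.
  rewrite [X in _ --> X](_ : _ = C * 0); last by rewrite mulr0.
  by apply: cvgMr; exact: inv_sqrt_ln_cvg0.
have H := ln_nat_dvg R 1.
have bound : \forall n \near \oo,
   `|erwE n (fun h => cos (dotr R d th (scaled_center n h) + phi)) - E n| <= C * inv_sqrt_ln R n.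
  near=> n.
  have l1 : 1 <= ln n%:R :> R by near: n; exact: H.
  have n1 : (1 < n)%N by near: n; exact: nbhs_infty_gt.
  have l0 : 0 < ln n%:R :> R by lra.
  have u0 : 0 < inv_sqrt_ln R n by rewrite invr_gt0 sqrtr_gt0.
  have u1 : inv_sqrt_ln R n <= 1.
    by rewrite invf_le1 ?sqrtr_gt0// -[leLHS]sqrtr1 ler_wsqrtr.
  set u := inv_sqrt_ln R n in u0 u1 *.
  (* Then L^2 >= 1 + ln n >= H_n, while u L = u + 1 stays bounded. *)
  pose L : R := 1 + Num.sqrt (ln n%:R).
  have sl0 : 0 < Num.sqrt (ln n%:R) :> R by rewrite sqrtr_gt0.
  have L0 : 0 < L by rewrite /L; lra.
  have HL : harm R n <= L ^+ 2.
    have -> : n = n.-1.+1 by rewrite prednK// ltnW.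
    rewrite (le_trans (harm_le_ln R n.-1))// prednK 1?ltnW//.
    by rewrite /L sqrrD expr1n mul1r sqr_sqrtr ?(ltW l0)//; lra.
  have cu0 : 0 <= ka * u by rewrite mulr_ge0// ltW.
  have := charf_bound R d d_gt0 w sum_scaled_step norm_scaled_step_le1 (ka * u) phi cu0 n L L0 HL (ltnW n1).
  have -> : (ka * u) ^+ 2 * mean_sqr R d w / 2 * harm R n = ka ^+ 2 * q / 2 * (harm R n / ln n%:R).
    have -> : (ka * u) ^+ 2 = ka ^+ 2 / ln n%:R.
      by rewrite exprMn /u /inv_sqrt_ln exprVn sqr_sqrtr// ltW.
    by rewrite -/q; field; rewrite gt_eqF.
  have e1 : (ka * u) ^+ 2 * L = ka ^+ 2 * (u ^+ 2 + u).
    have -> : u ^+ 2 + u = u ^+ 2 * L; last by ring.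
    by rewrite /L /u /inv_sqrt_ln; field; rewrite gt_eqF.
  have p2 : u ^+ 2 <= u by rewrite expr2 ler_piMl// ltW.
  have p3 : u ^+ 3 <= u by rewrite exprS ler_piMr ?exprn_ile1// ltW.
  have p4 : u ^+ 4 <= u by rewrite exprS ler_piMr ?exprn_ile1// ltW.
  rewrite -/(E n) => b1.
  have := charf_center n n1; rewrite -/ka -/u => b2.
  rewrite -(subrKA (charf R d w (ka * u) phi n)) (le_trans (ler_normD _ _))//.
  apply: (le_trans (lerD b2 b1)).
  have -> : 2 * (ka * u) ^+ 2 * L = 2 * (ka ^+ 2 * (u ^+ 2 + u)) by rewrite -e1 mulrA.
  rewrite !(exprMn _ ka u) /C.
  have k2 : ka ^+ 2 * u ^+ 2 <= ka ^+ 2 * u by rewrite ler_wpM2l ?exprn_ge0 ?(ltW ka0).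
  have k3 : ka ^+ 3 * u ^+ 3 <= ka ^+ 3 * u by rewrite ler_wpM2l ?exprn_ge0 ?(ltW ka0).
  have k4 : ka ^+ 4 * u ^+ 4 <= ka ^+ 4 * u by rewrite ler_wpM2l ?exprn_ge0 ?(ltW ka0).
  lra.
exact: cvg_dist_cvg0 bound B0 EL.
Unshelve. all: by end_near. Qed.

End Scaled.

Lemma cos_center_cvg th phi :
  erwE n (fun h => cos (dotr R d th (scaled_center n h) + phi)) @[n --> \oo] -->
  expR (- (4 / (9 * d)%:R / 2 * \sum_i th 0 i ^+ 2)) * cos phi.
Proof.
(* The summand 1 keeps the scale positive when [th] is 0. *)
apply: (@charf_center_cvg th (1 + \sum_i `|th 0 i|)).
  by rewrite ltr_wpDr// sumr_ge0.
by move=> i; rewrite (bigD1 i)//= addrCA lerDl addr_ge0// sumr_ge0.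
Qed.

(** Tightness: with a = (2n+1)/3 <= n, T^2 <= 2 (T - a Y)^2 + 2 a^2 Y^2 has mean at most 2 n^3 (1 +
    H_n), against the normalization n^3 ln n. *)
Lemma scaled_center_sqr i : \forall n \near \oo,
  erwE n (fun h => scaled_center n h 0 i ^+ 2) <= 8.
Proof.
have H := ln_nat_dvg R 1.
near=> n.
have l1 : 1 <= ln n%:R :> R by near: n; exact: H.
have n1 : (0 < n)%N by near: n; exact: nbhs_infty_gt.
have nR : 0 < n%:R :> R by rewrite ltr0n.
have n1R : 1 <= n%:R :> R by rewrite ler1n.
have l0 : 0 < ln n%:R :> R by lra.
pose th : rv := delta_mx 0 i.
(* The factor [1^-1] gives the shape of the scaled step for K = 1. *)
pose v e := 1^-1 * proj_step th e.
have thK j : `|th 0 j| <= 1 by rewrite mxE; case: (_ && _); rewrite ?normr0 ?normr1.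
have v0 : \sum_e v e = 0 by exact: sum_scaled_step.
have v1 e : `|v e| <= 1 by exact: norm_scaled_step_le1.
have coordE x : x 0 i = dotr R d th x.
  rewrite /dotr (bigD1 i)//= mxE !eqxx mul1r big1 ?addr0// => j ji.
  by rewrite mxE (negbTE ji) andbF mul0r.
have EY := erwE_pathsum_sqr R d d_gt0 v n v0 v1.
have ED := erwE_possum_mart_sqr R d d_gt0 v n v0 v1.
have hl : harm R n <= 1 + ln n%:R by rewrite -(prednK n1) harm_le_ln.
pose c := (n%:R * ln n%:R)^-1 * n%:R^-1 ^+ 2 : R.
have c0 : 0 <= c by rewrite mulr_ge0 ?sqr_ge0// invr_ge0 mulr_ge0// ltW.
apply: (@le_trans _ _ (erwE n (fun h =>
  c * 2 * (possum R d v h - (2 * n%:R + 1) / 3 * pathsum R d v h) ^+ 2 +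
  c * 2 * n%:R ^+ 2 * pathsum R d v h ^+ 2))).
  apply: le_erwE => // h hn.
  rewrite coordE dotr_scaled_center// (possum_proj th 1)// mul1r -/v.
  rewrite !exprMn exprVn sqr_sqrtr; last by rewrite mulr_ge0// ltW.
  have -> : c * 2 * (possum R d v h - (2 * n%:R + 1) / 3 * pathsum R d v h) ^+ 2 +
      c * 2 * n%:R ^+ 2 * pathsum R d v h ^+ 2 =
    c * (2 * ((possum R d v h - (2 * n%:R + 1) / 3 * pathsum R d v h) ^+ 2 +
      n%:R ^+ 2 * pathsum R d v h ^+ 2)) by ring.
  rewrite mulrA -/c ler_wpM2l//.
  set T := possum _ _ _ _; set Y := pathsum _ _ _ _.
  set a := (2 * n%:R + 1) / 3.
  have a2 : a ^+ 2 <= n%:R ^+ 2.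
    by rewrite lerXn2r ?nnegrE ?(ltW nR)// /a; lra.
  have : a ^+ 2 * Y ^+ 2 <= n%:R ^+ 2 * Y ^+ 2 by rewrite ler_wpM2r// sqr_ge0.
  have := sqr_ge0 (T - 2 * (a * Y)).
  have -> : (T - 2 * (a * Y)) ^+ 2 = 2 * ((T - a * Y) ^+ 2 + a ^+ 2 * Y ^+ 2) - T ^+ 2 by ring.
  lra.
rewrite erwED !erwEZ.
have A1 := ler_wpM2l (mulr_ge0 c0 (ler0n R 2)) ED.
have A2 := ler_wpM2l (mulr_ge0 (mulr_ge0 c0 (ler0n R 2)) (sqr_ge0 n%:R)) EY.
apply: (le_trans (lerD A1 A2)).
have -> : c * 2 * n%:R ^+ 3 + c * 2 * n%:R ^+ 2 * (n%:R * harm R n) =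
  (2 + 2 * harm R n) / ln n%:R.
  by rewrite /c; field; rewrite !gt_eqF.
rewrite ler_pdivrMr//; lra.
Unshelve. all: by end_near. Qed.

Lemma trigpoly_center_cvg P : trigpoly R d P ->
  erwE n (fun h => P (scaled_center n h)) @[n --> \oo] -->
  gauss_expect (Num.sqrt (4 / (9 * d)%:R)) P.
Proof.
have d0 := dR_gt0 R d d_gt0.
have s20 : 0 < 4 / (9 * d)%:R :> R by rewrite divr_gt0// ltr0n muln_gt0.
have s0 : 0 < Num.sqrt (4 / (9 * d)%:R) :> R by rewrite sqrtr_gt0.
elim=> [a th ph|f g tf cf tg cg].
  rewrite gauss_expect_cos// -mulrA sqr_sqrtr ?(ltW s20)//.
  under eq_fun do rewrite erwEZ.
  by apply: cvgMr; exact: cos_center_cvg.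
rewrite /gauss_expect gauss_iterD//.
under eq_fun do rewrite erwED.
by apply: cvgD.
Qed.

(** Three approximations: [f] by [P m] on the Gaussian side, [P m] along the walk, and [f] by [P m]
    along the walk. The index [m] is fixed before [n] grows. *)
Lemma bounded_continuous_center_cvg (f : rv -> R) (M : R) : continuous f ->
  (forall x, `|f x| <= M) ->
  erwE n (fun h => f (scaled_center n h)) @[n --> \oo] -->
  gauss_expect (Num.sqrt (4 / (9 * d)%:R)) f.
Proof.
move=> fcont fM.
have s20 : 0 < 4 / (9 * d)%:R :> R by rewrite divr_gt0// ltr0n muln_gt0.
have s0 : 0 < Num.sqrt (4 / (9 * d)%:R) :> R by rewrite sqrtr_gt0.
set s := Num.sqrt _ in s0 *.
have M0 : 0 <= M by rewrite (le_trans _ (fM 0)).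
have /choice[P PP] : forall m : nat, exists P, [/\ trigpoly R d P, forall x, `|P x| <= M &
    forall x : rv, (forall i, `|x 0 i| <= m.+1%:R) -> `|f x - P x| <= m.+1%:R^-1].
  by move=> m; exact: trigpoly_approx.
have Pf x : P m x @[m --> \oo] --> f x.
  apply: (@cvg_dist_cvg0 R _ (fun=> f x) harmonic); last 2 first.
  - exact: cvg_harmonic.
  - exact: cvg_cst.
  exists (Num.bound (\sum_i `|x 0 i|)) => // m /= mx.
  have [_ _ H] := PP m; rewrite distrC; apply: H => i.
  have S0 : 0 <= \sum_i `|x 0 i| by rewrite sumr_ge0.
  rewrite (@le_trans _ _ (\sum_i `|x 0 i|))//.
    by rewrite (bigD1 i)//= lerDl sumr_ge0.
  rewrite (le_trans (ltW (archi_boundP S0)))// ler_nat.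
  exact: leqW.
have GP : gauss_expect s (P m) @[m --> \oo] --> gauss_expect s f.
  apply: (@gauss_iter_dominated R d s s0 P f M) => //.
  - by move=> m; have [] := PP m.
  - by move=> m; have [] := PP m.
apply/cvgrPdist_le => e e0.
(* Along the walk the cube costs 1/(m+1), and its complement 2M times 8d/(m+1) by Markov's
   inequality, with 8 from [scaled_center_sqr]. *)
pose C := 1 + 2 * M * (8 * d%:R).
have C0 : 0 <= C by rewrite /C addr_ge0// !mulr_ge0.
have e30 : 0 < e / 3 by rewrite divr_gt0.
have HC : C * harmonic m @[m --> \oo] --> 0.
  rewrite [X in _ --> X](_ : _ = C * 0); last by rewrite mulr0.
  by apply: cvgMr; exact: cvg_harmonic.
have [m [m1 m2]] : exists m : nat, `|gauss_expect s f - gauss_expect s (P m)| <= e / 3 /\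
    C * m.+1%:R^-1 <= e / 3.
  have /cvgrPdist_le /(_ _ e30) G1 := GP.
  have /cvgrPdist_le /(_ _ e30) G2 := HC.
  near \oo => m; exists m; split; first by near: m; exact: G1.
  have : `|0 - C * harmonic m| <= e / 3 by near: m; exact: G2.
  by rewrite sub0r normrN; exact: le_trans (ler_norm _).
have [tP PM Pm] := PP m.
have /cvgrPdist_le /(_ _ e30) K1 := trigpoly_center_cvg (P m) tP.
have K2 : \forall n \near \oo, forall i, erwE n (fun h => scaled_center n h 0 i ^+ 2) <= 8.
  by apply: filter_forall => i; exact: scaled_center_sqr.
near=> n.
have k1 : `|gauss_expect s (P m) - erwE n (fun h => P m (scaled_center n h))| <= e / 3.
  by near: n; exact: K1.
have k2 i : erwE n (fun h => scaled_center n h 0 i ^+ 2) <= 8.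
  by move: i; near: n; exact: K2.
have k3 : `|erwE n (fun h => P m (scaled_center n h)) - erwE n (fun h => f (scaled_center n h))| <= e / 3.
  rewrite distrC -erwEB.
  have mR : 0 < m.+1%:R :> R by rewrite ltr0n.
  have m1R : m.+1%:R^-1 <= 1 :> R by rewrite invf_le1// ler1n.
  have mi0 : 0 < m.+1%:R^-1 :> R by rewrite invr_gt0.
  apply: (@le_trans _ _ (erwE n (fun h => m.+1%:R^-1 +
     2 * M * m.+1%:R^-1 * \sum_i scaled_center n h 0 i ^+ 2))).
    apply: ler_norm_erwE => // h _; move: (scaled_center n h) => x.
    have S0 : 0 <= \sum_i x 0 i ^+ 2 by apply: sumr_ge0 => i _; exact: sqr_ge0.
    have [/forallP xi|] := boolP [forall i, `|x 0 i| <= m.+1%:R].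
      by rewrite (le_trans (Pm x xi))// lerDl !mulr_ge0// ltW.
    rewrite negb_forall => /existsP[i]; rewrite -ltNge => xi.
    apply: (@le_trans _ _ (2 * M)).
      by rewrite (le_trans (ler_normB _ _))// mulr_natl mulr2n lerD.
    (* As |x_i| > m + 1 >= 1, its square exceeds m + 1; this first power suffices. *)
    have h1 : m.+1%:R <= \sum_i x 0 i ^+ 2.
      rewrite (bigD1 i)//= -(real_normK (num_real (x 0 i))).
      have h2 : 0 <= \sum_(j | j != i) x 0 j ^+ 2 by apply: sumr_ge0 => j _; exact: sqr_ge0.
      have h3 : 1 <= m.+1%:R :> R by rewrite ler1n.
      by nra.
    apply: (@le_trans _ _ (2 * M * m.+1%:R^-1 * \sum_i x 0 i ^+ 2)); last first.
      by rewrite lerDr ltW.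
    by rewrite -mulrA ler_peMr ?mulr_ge0// mulrC ler_pdivlMr// mul1r.
  rewrite erwED erwE1// erwEZ.
  have -> : erwE n (fun h => \sum_i scaled_center n h 0 i ^+ 2) =
     \sum_i erwE n (fun h => scaled_center n h 0 i ^+ 2).
    rewrite exchange_big/=; apply: eq_bigr => t _; by rewrite mulr_sumr.
  apply: (le_trans _ m2).
  have -> : C * m.+1%:R^-1 = m.+1%:R^-1 + 2 * M * m.+1%:R^-1 * (8 * d%:R).
    by rewrite /C; ring.
  rewrite lerD2l ler_wpM2l ?mulr_ge0 ?(ltW mi0)//.
  rewrite mulr_natr -[d in leRHS]card_ord -sumr_const; apply: ler_sum => i _; exact: k2.
have -> : e = e / 3 + (e / 3 + e / 3) by field.
rewrite -(subrKA (gauss_expect s (P m))) (le_trans (ler_normD _ _))// lerD//.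
rewrite -(subrKA (erwE n (fun h => P m (scaled_center n h)))) (le_trans (ler_normD _ _))//.
exact: lerD.
Unshelve. all: by end_near. Qed.

End Projections.

(** Convergence in law is tested on bounded continuous functions; [gauss_expect] takes the standard
    deviation, hence the square root of 4/(9d). *)
Theorem theorem2p6 (R : realType) (d : nat) (hd : (1 <= d)%N)
  (f : 'rV[R]_d -> R) (fcont : continuous f)
  (fbnd : exists M : R, forall x, `|f x| <= M) :
  let p : R := (2 * d + 1)%:R / (4 * d)%:R in
  (fun n : nat => erw_expect p (fun s : n.-tuple (dir d) =>
      f ((Num.sqrt (n%:R * ln n%:R))^-1 *: erw_center R n s)))
    @ \oo --> gauss_expect (Num.sqrt (4 / (9 * d)%:R)) f.
Proof.
have [M fM] := fbnd.
exact: (bounded_continuous_center_cvg R d hd f M fcont fM).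
Qed.
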